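(* Let $G$ be a finite group, and consider finite-dimensional $G$-graded division algebras over $\mathbb{R}$. Let $R$ denote the base algebra of such a graded division algebra. Then $R$ is (up to isomorphism) either $\mathbb{R}$, $\mathbb{H}$ or $\mathbb{C}$, and: \begin{enumerate} \item For $R=\mathbb{R}$, the graded isomorphism classes are exactly the twisted group algebras $\mathbb{R}^{\alpha}G$, where $\alpha$ runs over the distinct classes in $H^2(G,\mathbb{R}^* )$. \item For $R=\mathbb{H}$, there is a one-to-one correspondence between the graded isomorphism classes and the distinct classes in $H^2(G,\mathbb{R}^* )$. \item For $R=\mathbb{C}$, the kernel of the associated action $\eta:G\to\mathrm{Aut}_{\mathbb{R}}(\mathbb{C})$ is a subgroup $N$ which is either $G$ or a subgroup of index $2$; in other words, there is an identification between the non-trivial actions $\eta$ and the subgroups of $G$ of index $2$. For each such $N$ (with $\eta$ the action with kernel $N$) there is a one-to-one correspondence between the graded isomorphism classes of graded division algebras with base algebra $\mathbb{C}$ and associated action $\eta$, and the distinct sets $\{[\alpha],[\bar{\alpha}]\}$ with $[\alpha]\in H^2_{\eta}(G,\mathbb{C}^* )$. \end{enumerate}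
   Context: A $G$-grading of an associative (unital) $\mathbb{R}$-algebra $A$ is a vector space decomposition $A=\bigoplus_{g\in G}A_g$ with $A_gA_h\subseteq A_{gh}$. The subalgebra $A_e$ ($e$ the identity of $G$) is called the base algebra. $A$ is a $G$-graded division algebra if $A_g\neq\{0\}$ for every $g\in G$ and every nonzero $a\in A_g$, $g \in G$, is invertible. Two $G$-graded $\mathbb{R}$-algebras $A,B$ are graded isomorphic if there is an $\mathbb{R}$-algebra isomorphism $\psi:A\to B$ with $\psi(A_g)=B_g$ for all $g\in G$. Given a $G$-graded division algebra with base algebra $R=A_e$, choosing nonzero $u_g\in A_g$ for each $g$ gives a map $\eta:G\to\mathrm{Aut}_{\mathbb{R}}(R)$, $\eta(g)(r)=u_gru_g^{-1}$; when $R$ is commutative, $\eta$ is a group homomorphism independent of the choice of the $u_g$. For $R=\mathbb{C}$, $\mathrm{Aut}_{\mathbb{R}}(\mathbb{C})$ consists of the identity and complex conjugation. $\mathbb{H}$ is the real quaternion algebra. $H^2(G,\mathbb{R}^* )$ is the second cohomology group with trivial $G$-action on $\mathbb{R}^*$. $H^2_{\eta}(G,\mathbb{C}^* )$ is the second cohomology group with $G$ acting on $\mathbb{C}^*$ via $\eta$. For a 2-cocycle $\alpha$, $\bar{\alpha}$ is the cocycle $\bar\alpha(g,h)=\overline{\alpha(g,h)}$ (complex conjugate), and $[\alpha]$ is the class of $\alpha$. The twisted group algebra $\mathbb{R}^{\alpha}G$ has $\mathbb{R}$-basis $\{u_g\}_{g\in G}$ with multiplication $u_gu_h=\alpha(g,h)u_{gh}$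 ($\mathbb{R}$ central), graded by $(\mathbb{R}^{\alpha}G)_g=\mathbb{R}u_g$. *)

(* Defs.v *)
From HB Require Import structures.
From mathcomp Require Import all_boot all_order all_algebra all_fingroup all_field.
From mathcomp Require Import complex.
From mathcomp Require Import ring.
From mathcomp Require Import all_classical reals.

Set Implicit Arguments.
Unset Strict Implicit.
Unset Printing Implicit Defensive.

Import Order.TTheory GRing.Theory Num.Theory.

Local Open Scope ring_scope.
Local Open Scope classical_set_scope.

(* The complex numbers as an algebra over the reals.  [R[i]] is by default an
   algebra over itself; its alias [Rcomplex R] is the one with scalars in [R]. *)
Section RcomplexFalgebra.
Variable R : rcfType.

Fact Rcomplex_scaleAr (k : R) (x y : Rcomplex R) :
  k *: (x * y) = x * (k *: y).
Proof. by rewrite [x * y]mulrC scalerAl mulrC. Qed.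

HB.instance Definition _ :=
  GRing.Lalgebra_isAlgebra.Build R (Rcomplex R) Rcomplex_scaleAr.

Definition Rcomplex_row (z : Rcomplex R) : 'rV[R]_2 :=
  \row_i [:: complex.Re z; complex.Im z]`_i.

Fact Rcomplex_vect_iso : Vector.axiom 2 (Rcomplex R).
Proof.
exists Rcomplex_row.
  move=> a x y; apply/rowP => i; rewrite !mxE.
  by case: i => -[|[|//]] /= _; rewrite raddfD /= linearZ.
exists (fun v : 'rV[R]_2 => Complex (v 0 0) (v 0 1)) => [[a b]|v].
  by rewrite !mxE.
apply/rowP => i; rewrite !mxE.
by case: i => -[|[|//]] /= Hi; congr (v _ _); apply: val_inj.
Qed.

HB.instance Definition _ :=
  Lmodule_hasFinDim.Build R (Rcomplex R) Rcomplex_vect_iso.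

End RcomplexFalgebra.

(* [Quat a b c d] is a + b i + c j + d k. *)
Record quat (R : Type) : Type := Quat { q1 : R; qi : R; qj : R; qk : R }.

Section Quaternion.
Variable R : fieldType.
Local Notation H := (quat R).
Implicit Types x y z : H.

Definition quat_tuple x := (q1 x, qi x, qj x, qk x).
Definition tuple_quat (t : R * R * R * R) : H :=
  let: (a, b, c, d) := t in Quat a b c d.
Fact quat_tupleK : cancel quat_tuple tuple_quat. Proof. by case. Qed.

HB.instance Definition _ := Choice.copy H (can_type quat_tupleK).

Definition quat_zero : H := Quat 0 0 0 0.
Definition quat_opp x : H := Quat (- q1 x) (- qi x) (- qj x) (- qk x).
Definition quat_add x y : H :=
  Quat (q1 x + q1 y) (qi x + qi y) (qj x + qj y) (qk x + qk y).

Fact quat_addA : associative quat_add.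
Proof. by move=> x y z; congr Quat; rewrite addrA. Qed.
Fact quat_addC : commutative quat_add.
Proof. by move=> x y; congr Quat; rewrite addrC. Qed.
Fact quat_add0 : left_id quat_zero quat_add.
Proof. by case=> *; congr Quat; rewrite add0r. Qed.
Fact quat_addN : left_inverse quat_zero quat_opp quat_add.
Proof. by case=> *; congr Quat; rewrite addNr. Qed.

HB.instance Definition _ :=
  GRing.isZmodule.Build H quat_addA quat_addC quat_add0 quat_addN.

Definition quat_one : H := Quat 1 0 0 0.
Definition quat_mul x y : H :=
  Quat (q1 x * q1 y - qi x * qi y - qj x * qj y - qk x * qk y)
       (q1 x * qi y + qi x * q1 y + qj x * qk y - qk x * qj y)
       (q1 x * qj y - qi x * qk y + qj x * q1 y + qk x * qi y)
       (q1 x * qk y + qi x * qj y - qj x * qi y + qk x * q1 y).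

Fact quat_mulA : associative quat_mul.
Proof. by move=> x y z; congr Quat => /=; ring. Qed.
Fact quat_mul1l : left_id quat_one quat_mul.
Proof. by case=> a b c d; congr Quat => /=; ring. Qed.
Fact quat_mul1r : right_id quat_one quat_mul.
Proof. by case=> a b c d; congr Quat => /=; ring. Qed.
Fact quat_mulDl : left_distributive quat_mul +%R.
Proof. by move=> x y z; congr Quat => /=; ring. Qed.
Fact quat_mulDr : right_distributive quat_mul +%R.
Proof. by move=> x y z; congr Quat => /=; ring. Qed.
Fact quat_one_neq0 : quat_one != 0.
Proof. by apply/eqP => -[] /eqP; rewrite oner_eq0. Qed.

HB.instance Definition _ := GRing.Zmodule_isNzRing.Build H
  quat_mulA quat_mul1l quat_mul1r quat_mulDl quat_mulDr quat_one_neq0.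

Definition quat_scale (k : R) x : H :=
  Quat (k * q1 x) (k * qi x) (k * qj x) (k * qk x).

Fact quat_scaleA a b x : quat_scale a (quat_scale b x) = quat_scale (a * b) x.
Proof. by congr Quat; rewrite /= mulrA. Qed.
Fact quat_scale1 : left_id 1 quat_scale.
Proof. by case=> *; congr Quat; rewrite /= mul1r. Qed.
Fact quat_scaleDr : right_distributive quat_scale +%R.
Proof. by move=> k x y; congr Quat; rewrite /= mulrDr. Qed.
Fact quat_scaleDl x : {morph quat_scale^~ x : a b / a + b}.
Proof. by move=> a b; congr Quat; rewrite /= mulrDl. Qed.

HB.instance Definition _ := GRing.Zmodule_isLmodule.Build R H
  quat_scaleA quat_scale1 quat_scaleDr quat_scaleDl.

Fact quat_scaleAl (k : R) x y : k *: (x * y) = k *: x * y.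
Proof. by congr Quat => /=; ring. Qed.
Fact quat_scaleAr (k : R) x y : k *: (x * y) = x * (k *: y).
Proof. by congr Quat => /=; ring. Qed.

HB.instance Definition _ := GRing.Lmodule_isLalgebra.Build R H quat_scaleAl.
HB.instance Definition _ := GRing.Lalgebra_isAlgebra.Build R H quat_scaleAr.

Definition quat_row x : 'rV[R]_4 := \row_i [:: q1 x; qi x; qj x; qk x]`_i.

Fact quat_vect_iso : Vector.axiom 4 H.
Proof.
exists quat_row.
  move=> a x y; apply/rowP => i; rewrite !mxE.
  by case: i => -[|[|[|[|//]]]].
exists (fun v : 'rV[R]_4 => Quat (v 0 0) (v 0 1) (v 0 2%:R) (v 0 3%:R)).
  by case=> a b c d; rewrite !mxE.
move=> v; apply/rowP => i; rewrite !mxE.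
by case: i => -[|[|[|[|//]]]] /= Hi; congr (v _ _); apply: val_inj.
Qed.

HB.instance Definition _ := Lmodule_hasFinDim.Build R H quat_vect_iso.
HB.instance Definition _ := Algebra_isFalgebra.Build R H.

End Quaternion.

Record gradedAlg (K : fieldType) (gT : finGroupType) := GradedAlg {
  carrier :> falgType K;
  hcomp : gT -> {vspace carrier};
  hcomp_full : (\sum_g hcomp g)%VS = fullv;
  hcomp_direct : directv (\sum_g hcomp g)%VS;
  hcompM : forall g h, (hcomp g * hcomp h <= hcomp (g * h)%g)%VS
}.

Section GradedAlg.
Variables (K : fieldType) (gT : finGroupType).
Implicit Types A B : gradedAlg K gT.

Lemma mem1_hcomp1 A : 1 \in hcomp A 1%g.
Proof.
have /memv_sumP[u uA Du] : (1 : A) \in (\sum_g hcomp A g)%VS.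
  by rewrite hcomp_full memvf.
suff e1 (x : A) : x * u 1%g = x.
  by rewrite -[1]e1 mul1r; apply: uA.
have hom h (a : A) : a \in hcomp A h -> a * u 1%g = a.
  move=> Aa; pose v g : A := a * u (h^-1 * g)%g - (if g == h then a else 0).
  have vA g : g \in predT -> v g \in hcomp A g.
    move=> _; apply: rpredB.
      have := subvP (hcompM A h (h^-1 * g)%g) _ (memv_mul Aa (uA _ isT)).
      by rewrite mulKVg.
    by case: eqP => [->|_]; rewrite ?mem0v.
  have v0 : \sum_g v g = 0.
    rewrite sumrB -big_mkcond big_pred1_eq -mulr_sumr.
    rewrite (reindex_inj (mulgI h)) /=.
    by under eq_bigr do rewrite mulKg; rewrite -Du mulr1 subrr.
  have /directv_sum_independent/(_ v vA v0 h isT) := hcomp_direct A.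
  by rewrite /v eqxx mulVg => /eqP; rewrite subr_eq0 => /eqP.
have /memv_sumP[w wA ->] : x \in (\sum_g hcomp A g)%VS.
  by rewrite hcomp_full memvf.
by rewrite mulr_suml; apply: eq_bigr => g _; apply: hom (wA _ _).
Qed.

Fact base_is_aspace A : is_aspace (hcomp A 1%g).
Proof.
rewrite /is_aspace has_algid1 ?mem1_hcomp1 //=.
by have := hcompM A 1%g 1%g; rewrite mulg1.
Qed.

Definition base_alg A : {aspace A} := ASpace (base_is_aspace A).

Definition graded_division A : Prop :=
  (forall g, hcomp A g != 0%VS) /\
  (forall g (a : A), a \in hcomp A g -> a != 0 -> a \is a GRing.unit).

Definition graded_iso A B : Prop :=
  exists f : 'AHom(A, B),
    bijective f /\ forall g, (f @: hcomp A g)%VS = hcomp B g.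

Definition has_base (D : falgType K) A : Prop :=
  exists f : 'AHom(D, subvs_of (base_alg A)), bijective f.

Definition gda_over (D : falgType K) A : Prop :=
  graded_division A /\ has_base D A.

(* A bijection between the graded isomorphism classes of the algebras
   satisfying P and the elements of T.  It is given by a function on algebras
   that is constant exactly on isomorphism classes: as [gradedAlg] is a large
   type, the classes cannot be collected into a [set]. *)
Definition iso_classes_bijection (P : gradedAlg K gT -> Prop)
    (X : Type) (T : set X) : Prop :=
  exists Phi : gradedAlg K gT -> X,
    [/\ forall A, P A -> T (Phi A),
        forall A B, P A -> P B -> (Phi A = Phi B <-> graded_iso A B) &
        forall c, T c -> exists2 A, P A & Phi A = c].

End GradedAlg.

Section Cohomology.
Variables (F : fieldType) (gT : finGroupType) (act : gT -> F -> F).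
Implicit Types a b : gT -> gT -> F.

(* Cocycles are not assumed to be normalised. *)
Definition cocycle2 a : Prop :=
  (forall g h, a g h != 0) /\
  (forall g h k, a g h * a (g * h)%g k = act g (a h k) * a g (h * k)%g).

Definition cohomologous a b : Prop :=
  exists2 l : gT -> F, (forall g, l g != 0) &
    forall g h, b g h = a g h * (l g * act g (l h) / l (g * h)%g).

Definition cls a : set (gT -> gT -> F) := [set b | cohomologous a b].

Definition H2 : set (set (gT -> gT -> F)) := [set cls a | a in cocycle2].

End Cohomology.

Definition trivial_act (F : fieldType) (gT : finGroupType) : gT -> F -> F :=
  fun _ x => x.

Section TwistedGroupAlgebra.
Variables (F : fieldType) (gT : finGroupType) (a : gT -> gT -> F).
Hypothesis ha : cocycle2 (@trivial_act F gT) a.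

(* The function f stands for the combination of the u_g with coefficients f g. *)
Definition twisted_of & cocycle2 (@trivial_act F gT) a := {ffun gT -> F^o}.
Local Notation T := (twisted_of ha).
HB.instance Definition _ := Vector.on T.

Definition tw_basis (g : gT) : T := [ffun h => (h == g)%:R : F^o].

(* The unit is not u_1 itself, as cocycles are not normalised. *)
Definition tw_one : T := (a 1%g 1%g)^-1 *: tw_basis 1%g.
Definition tw_mul (x y : T) : T :=
  [ffun k => \sum_g x g * y (g^-1 * k)%g * a g (g^-1 * k)%g : F^o].

Let aM g h k : a g h * a (g * h)%g k = a h k * a g (h * k)%g.
Proof. by case: ha => _; apply. Qed.

Let a_g1 g : a g 1%g = a 1%g 1%g.
Proof.
by have := aM g 1%g 1%g; rewrite !mulg1; apply: mulIf; case: ha.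
Qed.

Let a_1g g : a 1%g g = a 1%g 1%g.
Proof.
by have := aM 1%g 1%g g; rewrite !mul1g => /esym; apply: mulIf; case: ha.
Qed.

Fact tw_mulA : associative tw_mul.
Proof.
move=> x y z; apply/ffunP => k; rewrite !ffunE.
transitivity (\sum_h \sum_g
    x h * (y (h^-1 * g)%g * z (g^-1 * k)%g * a (h^-1 * g)%g (g^-1 * k)%g)
    * a h (h^-1 * k)%g).
  apply: eq_bigr => h _; rewrite ffunE mulr_sumr mulr_suml.
  rewrite (reindex_inj (mulgI (h^-1)%g)) /=; apply: eq_bigr => g _.
  by rewrite invMg invgK -!mulgA mulKVg.
rewrite exchange_big /=; apply: eq_bigr => g _.
rewrite ffunE !mulr_suml; apply: eq_bigr => h _.
have := aM h (h^-1 * g)%g (g^-1 * k)%g; rewrite mulKVg -mulgA mulKVg => E.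
transitivity (x h * y (h^-1 * g)%g * z (g^-1 * k)%g *
  (a (h^-1 * g)%g (g^-1 * k)%g * a h (h^-1 * k)%g)); first by ring.
by rewrite -E; ring.
Qed.

Fact tw_mul1l : left_id tw_one tw_mul.
Proof.
move=> x; apply/ffunP => k; rewrite !ffunE (bigD1 1%g) //= big1 => [|g ng1].
  rewrite !ffunE eqxx addr0 invg1 mul1g a_1g /GRing.scale /= mulr1 mulrAC mulVf ?mul1r //.
  by case: ha.
by rewrite !ffunE (negPf ng1) scaler0 !mul0r.
Qed.

Fact tw_mul1r : right_id tw_one tw_mul.
Proof.
move=> x; apply/ffunP => k; rewrite !ffunE (bigD1 k) //= big1 => [|g ngk].
  rewrite !ffunE mulVg eqxx addr0 a_g1 /GRing.scale /= mulr1 mulfVK //.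
  by case: ha.
rewrite !ffunE -(inj_eq (mulgI g)) mulKVg mulg1 eq_sym (negPf ngk).
by rewrite scaler0 mulr0 mul0r.
Qed.

Fact tw_mulDl : left_distributive tw_mul +%R.
Proof.
move=> x y z; apply/ffunP => k; rewrite !ffunE -big_split /=.
by apply: eq_bigr => g _; rewrite !ffunE !mulrDl.
Qed.

Fact tw_mulDr : right_distributive tw_mul +%R.
Proof.
move=> x y z; apply/ffunP => k; rewrite !ffunE -big_split /=.
by apply: eq_bigr => g _; rewrite !ffunE mulrDr mulrDl.
Qed.

Fact tw_one_neq0 : tw_one != 0.
Proof.
apply/eqP => /ffunP/(_ 1%g); rewrite !ffunE eqxx /GRing.scale /= mulr1.
by move/eqP; rewrite invr_eq0; apply/negP; case: ha.
Qed.

HB.instance Definition _ := GRing.Zmodule_isNzRing.Build T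
  tw_mulA tw_mul1l tw_mul1r tw_mulDl tw_mulDr tw_one_neq0.

Fact tw_scaleAl (k : F) (x y : T) : k *: (x * y) = k *: x * y.
Proof.
apply/ffunP => h; rewrite !ffunE scaler_sumr; apply: eq_bigr => g _.
by rewrite ffunE /GRing.scale /= !mulrA.
Qed.
Fact tw_scaleAr (k : F) (x y : T) : k *: (x * y) = x * (k *: y).
Proof.
apply/ffunP => h; rewrite !ffunE scaler_sumr; apply: eq_bigr => g _.
by rewrite ffunE /GRing.scale /=; ring.
Qed.

HB.instance Definition _ := GRing.Lmodule_isLalgebra.Build F T tw_scaleAl.
HB.instance Definition _ := GRing.Lalgebra_isAlgebra.Build F T tw_scaleAr.
HB.instance Definition _ := Algebra_isFalgebra.Build F T.

Lemma tw_basisM g h : tw_basis g * tw_basis h = a g h *: tw_basis (g * h)%g.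
Proof.
apply/ffunP => k; rewrite !ffunE (bigD1 g) //= big1 => [|x nxg].
  rewrite !ffunE eqxx mul1r addr0 /GRing.scale /= -(inj_eq (mulgI g)) mulKVg.
  by case: eqP => [->|_]; rewrite ?mulKg ?mulr1 ?mul1r // mulr0 mul0r.
by rewrite !ffunE (negPf nxg) !mul0r.
Qed.

Definition tw_comp (g : gT) : {vspace T} := <[tw_basis g]>%VS.

Lemma tw_sumE (x : T) : x = \sum_g (x g : F) *: tw_basis g.
Proof.
apply/ffunP => k; rewrite sum_ffunE (bigD1 k) //= big1 => [|g ngk].
  by rewrite !ffunE eqxx addr0 /GRing.scale /= mulr1.
by rewrite !ffunE eq_sym (negPf ngk) scaler0.
Qed.

Fact tw_full : (\sum_g tw_comp g)%VS = fullv.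
Proof.
apply/eqP; rewrite eqEsubv subvf /=; apply/subvP => x _; rewrite [x]tw_sumE.
by apply: memv_sumr => g _; rewrite memvZ ?memv_line.
Qed.

Fact tw_direct : directv (\sum_g tw_comp g)%VS.
Proof.
apply/directv_sum_independent => u uT u0 g _.
have uE h : u h = (u h h : F) *: tw_basis h.
  have /vlineP[k ->] := uT h isT.
  by rewrite !ffunE eqxx /GRing.scale /= mulr1.
suff z : u g g = 0 by rewrite uE z scale0r.
have := congr1 (fun x : T => x g) u0; rewrite sum_ffunE ffunE.
rewrite (bigD1 g) //= big1 ?addr0 // => h nhg.
by rewrite uE !ffunE eq_sym (negPf nhg) scaler0.
Qed.

Fact tw_compM g h : (tw_comp g * tw_comp h <= tw_comp (g * h)%g)%VS.
Proof. by rewrite prodv_line tw_basisM -memvE memvZ ?memv_line. Qed.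

Definition twisted_group_alg : gradedAlg F gT :=
  GradedAlg tw_full tw_direct tw_compM.

End TwistedGroupAlgebra.

Section ComplexBase.
Variables (R : rcfType) (gT : finGroupType).
Local Notation C := (Rcomplex R).
Implicit Type eta : gT -> 'AEnd(C).

(* Being a homomorphism, [eta] takes its values in the invertible
   endomorphisms, i.e., in the automorphisms of C over R. *)
Definition is_aut_action eta : Prop :=
  eta 1%g = \1%AF /\ forall g h, eta (g * h)%g = (eta g \o eta h)%AF.

Definition trivial_aut_action eta : Prop := forall g, eta g = \1%AF.

Definition aut_action_ker eta : {set gT} := [set g | eta g == \1%AF]%SET.

(* [eta g z = u z u^-1] for any nonzero u of degree g, the base algebra being
   identified with C along [psi]. *)
Definition associated_action (A : gradedAlg R gT) eta : Prop :=
  exists psi : 'AHom(C, subvs_of (base_alg A)), bijective psi /\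
    forall g (u : A) (z : C), u \in hcomp A g -> u != 0 ->
      u * vsval (psi z) / u = vsval (psi (eta g z)).

Definition conj_cochain (a : gT -> gT -> C) : gT -> gT -> C :=
  fun g h => conjc (a g h).

Definition conj_pair eta (a : gT -> gT -> C) : set (set (gT -> gT -> C)) :=
  [set cls (fun g z => eta g z) a; cls (fun g z => eta g z) (conj_cochain a)].

Definition conj_pairs eta : set (set (set (gT -> gT -> C))) :=
  [set conj_pair eta a | a in cocycle2 (fun g z => eta g z)].

Definition index2_subgroups : set {set gT} :=
  [set N : {set gT} | group_set N /\ #|[set: gT]%SET : N|%g = 2%N].

End ComplexBase.

(* Main.v *)
Require Import Defs.
From HB Require Import structures.
From mathcomp Require Import all_boot all_order all_algebra all_fingroup all_field.
From mathcomp Require Import complex.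
From mathcomp Require Import ring lra.
From mathcomp Require Import all_classical reals.

Set Implicit Arguments.
Unset Strict Implicit.
Unset Printing Implicit Defensive.

Import Order.TTheory GRing.Theory Num.Theory.

Local Open Scope ring_scope.
Local Open Scope classical_set_scope.

(** For a nonzero u_g in A_g one has A_g = A_e u_g, so a graded division algebra
    is determined by its base D = A_e, by how the u_g act on D, and by the
    D-valued function a with u_g u_h = a(g,h) u_gh; conversely these data give
    a crossed product.

    If D is R or H, the u_g can be chosen to commute with D: for H, average an
    element of A_g over the conjugations by 1, i, j, k.  Then a takes central,
    hence real, values, is a 2-cocycle for the trivial action, and the choice
    of the u_g changes it by a coboundary.  If D is C, conjugation by u_g is
    the action eta, a is a cocycle for eta, and besides the u_g one chooses the
    identification of A_e with C; the two identifications differ by complex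
    conjugation, whence the pairs of classes.  The three possibilities for D
    are Frobenius' theorem. *)

(** * Homogeneous components and the base algebra *)

Lemma inj_surj_bijective (T U : Type) (f : T -> U) :
  injective f -> (forall y, exists x, f x = y) -> bijective f.
Proof.
move=> f_inj /choice[g fg]; exists g => // x.
by apply: f_inj; rewrite fg.
Qed.

(** Right multiplication by [x] is injective, since a further multiplication by [y] undoes it. In
    finite dimension it is then onto, so 1 = v x for some v, and v = y. *)
Lemma right_inverse_unit (K : fieldType) (A : falgType K) (x y : A) :
  x * y = 1 -> x \is a GRing.unit.
Proof.
move=> xy1; have injx : lker (amulr x) == 0%VS.
  by apply/lker0P => v w; rewrite !lfunE /= => /(congr1 ( *%R^~ y));
    rewrite -!mulrA xy1 !mulr1.
have := lker0_lfunVK injx 1; rewrite lfunE /=.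
set v := _^-1%VF 1 => vx1; apply/unitrP; exists v; split=> //.
by have -> : v = y; rewrite // -[v]mulr1 -xy1 mulrA vx1 mul1r.
Qed.

Section GradedDivision.
Variables (K : fieldType) (gT : finGroupType) (A : gradedAlg K gT).

Lemma mem_hcompM g h (x y : A) :
  x \in hcomp A g -> y \in hcomp A h -> x * y \in hcomp A (g * h)%g.
Proof. by move=> Ax Ay; apply: subvP (hcompM A g h) _ (memv_mul Ax Ay). Qed.

Lemma mem_hcompX g (x : A) n : x \in hcomp A g -> x ^+ n \in hcomp A (g ^+ n)%g.
Proof.
move=> Ax; elim: n => [|n IHn]; first by rewrite expr0 expg0 mem1_hcomp1.
by rewrite exprS expgS mem_hcompM.
Qed.

(* As g has finite order, a power of x lies in the base algebra, which is
   closed under inverses. *)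
Lemma mem_hcompV g (x : A) :
  x \is a GRing.unit -> x \in hcomp A g -> x^-1 \in hcomp A g^-1%g.
Proof.
move=> Ux Ax; have Axn : x ^+ #[g]%g \in base_alg A.
  by have := mem_hcompX #[g]%g Ax; rewrite expg_order.
have -> : x^-1 = x ^+ #[g]%g.-1 * (x ^+ #[g]%g)^-1.
  rewrite -[in x ^+ #[g]%g](prednK (order_gt0 g)) exprS.
  by rewrite invrM ?unitrX // mulVKr ?unitrX.
rewrite -[g^-1%g]mulg1 invg_expg mem_hcompM ?mem_hcompX //.
by have := memvV (base_alg A) (x ^+ #[g]%g); rewrite Axn => ->.
Qed.

Hypothesis gdA : graded_division A.

Lemma hcomp_unit g (x : A) : x \in hcomp A g -> x != 0 -> x \is a GRing.unit.
Proof. by case: gdA => _; apply. Qed.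

Lemma hcomp_neq0P g : exists2 x : A, x \in hcomp A g & x != 0.
Proof.
exists (vpick (hcomp A g)); first exact: memv_pick.
by rewrite vpick0; case: gdA.
Qed.

Lemma mem_hcomp_div g (x y : A) : y != 0 ->
  x \in hcomp A g -> y \in hcomp A g -> x / y \in hcomp A 1%g.
Proof.
move=> y0 Ax Ay; rewrite -(mulgV g) mem_hcompM // mem_hcompV //.
exact: hcomp_unit Ay y0.
Qed.

End GradedDivision.

(** * Embeddings of the base algebra *)

Section BaseEmbedding.
Variables (K : fieldType) (gT : finGroupType) (D : falgType K).
Implicit Types A B : gradedAlg K gT.

(** Identifying A_e with [D] by a map into [A] itself lets base elements be multiplied directly with
    homogeneous ones, without passing through the subalgebra type. *)
Definition base_embedding A (p : 'AHom(D, A)) :=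
  injective p /\ limg p = hcomp A 1%g.

Lemma base_alg1 A : vsval (1 : subvs_of (base_alg A)) = 1.
Proof. by apply/eqP; rewrite algid_eq1 mem1_hcomp1. Qed.

Lemma base_embedding_subvs A (psi : 'AHom(D, subvs_of (base_alg A))) :
  bijective psi ->
  exists2 p : 'AHom(D, A), base_embedding p & forall z, p z = vsval (psi z).
Proof.
move=> psi_bij; pose f : 'Hom(D, A) := (linfun vsval \o psi)%VF.
have fE z : f z = vsval (psi z) by rewrite lfunE /= lfunE.
have fM : ahom_in fullv f.
  apply/ahomP_tmp; split; first by rewrite fE rmorph1 base_alg1.
  by move=> x y; rewrite !fE rmorphM.
exists (AHom fM) => //.
split; first by move=> x y; rewrite /= !fE => /val_inj/(bij_inj psi_bij).
apply/vspaceP => x; apply/memv_imgP/idP => [[z _ ->]|Ax].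
  by rewrite /= fE; exact: subvsP.
have [q qK Kq] := psi_bij; exists (q (vsproj (base_alg A) x));
  rewrite ?memvf //.
by rewrite /= fE Kq vsprojK.
Qed.

Lemma subvs_base_embedding A (p : 'AHom(D, A)) : base_embedding p ->
  exists2 psi : 'AHom(D, subvs_of (base_alg A)), bijective psi &
    forall z, vsval (psi z) = p z.
Proof.
case=> p_inj p_im.
have pE z : p z \in base_alg A.
  by have := memv_img p (memvf z); rewrite p_im.
pose f : 'Hom(D, subvs_of (base_alg A)) :=
  (linfun (vsproj (base_alg A)) \o p)%VF.
have fE z : vsval (f z) = p z by rewrite lfunE /= lfunE vsprojK.
have fM : ahom_in fullv f.
  apply/ahomP_tmp; split=> [|x y]; apply: val_inj.
    by rewrite -[RHS]/(vsval 1) base_alg1 -[LHS]/(vsval _) fE rmorph1.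
  by rewrite /= !fE rmorphM.
exists (AHom fM) => //.
apply: inj_surj_bijective => [x y /(congr1 vsval)|y];
  first by rewrite !fE => /p_inj.
have : vsval y \in limg p by rewrite p_im; exact: subvsP.
case/memv_imgP => z _ yE; exists z; apply/val_inj.
by rewrite -[LHS]/(vsval _) fE.
Qed.

Lemma has_baseP A :
  has_base D A <-> exists p : 'AHom(D, A), base_embedding p.
Proof.
split=> [[psi /base_embedding_subvs[p]]|[p /subvs_base_embedding[psi]]].
  by exists p.
by exists psi.
Qed.

End BaseEmbedding.

(** * Graded bases over the base algebra and coordinates *)

Section GradedBasis.
Variables (K : fieldType) (gT : finGroupType) (D : falgType K).
Implicit Types A B : gradedAlg K gT.

(** When [A] is a graded division algebra, the [u g] form a left basis over [D], and [s] and [a]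
    record the whole multiplication. *)
Record graded_basis A (p : 'AHom(D, A)) (s : gT -> D -> D)
    (a : gT -> gT -> D) (u : gT -> A) : Prop := GradedBasis {
  gb_base : base_embedding p;
  gb_mem : forall g, u g \in hcomp A g;
  gb_neq0 : forall g, u g != 0;
  gb_comm : forall g z, u g * p z = p (s g z) * u g;
  gb_mul : forall g h, u g * u h = p (a g h) * u (g * h)%g
}.

(** The data [s] and [a] survive an isomorphism unchanged, which is why isomorphic algebras receive
    the same invariant. *)
Lemma graded_basis_transport A B (f : 'AHom(A, B)) p s a u :
  bijective f -> (forall g, (f @: hcomp A g)%VS = hcomp B g) ->
  graded_basis p s a u -> graded_basis (f \o p)%AF s a (f \o u).
Proof.
move=> /bij_inj f_inj f_im [[p_inj p_im] uA u0 up uM]; split.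
- split=> [x y|]; first by rewrite !lfunE => /f_inj/p_inj.
  by rewrite limg_comp p_im f_im.
- by move=> g; rewrite -f_im memv_img.
- by move=> g; rewrite -(raddf0 f) (inj_eq f_inj).
- by move=> g z; rewrite !lfunE /= -!rmorphM up.
- by move=> g h; rewrite lfunE /= -!rmorphM uM.
Qed.

Section Coordinates.
Variables (A : gradedAlg K gT) (p : 'AHom(D, A)) (u : gT -> A).

Definition gb_sum (x : {ffun gT -> D}) : A := \sum_g p (x g) * u g.

Fact gb_sum_linear : linear gb_sum.
Proof.
move=> k x y; rewrite /gb_sum scaler_sumr -big_split /=; apply: eq_bigr => g _.
by rewrite !ffunE linearP mulrDl scalerAl.
Qed.
HB.instance Definition _ := GRing.isSemilinear.Build K {ffun gT -> D} A _ gb_sum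
  (GRing.semilinear_linear gb_sum_linear).

Variables (s : gT -> D -> D) (a : gT -> gT -> D).
Hypotheses (gdA : graded_division A) (pu : graded_basis p s a u).

(** As [u g] is invertible of degree g, the quotient of [x] by it has degree e and so comes from
    [D]: this is A_g = A_e u_g. *)
Lemma gb_hcompP g x : reflect (exists z, x = p z * u g) (x \in hcomp A g).
Proof.
have [[_ p_im] uA u0 _ _] := pu.
apply: (iffP idP) => [Ax|[z ->]].
  have := mem_hcomp_div gdA (u0 g) Ax (uA g).
  rewrite -p_im => /memv_imgP[z _ zE]; exists z.
  by rewrite -zE divrK ?(hcomp_unit gdA (uA g)).
by rewrite -[g in hcomp A g]mul1g mem_hcompM // -p_im memv_img ?memvf.
Qed.

Lemma gb_sum_inj : injective gb_sum.
Proof.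
have [[p_inj p_im] uA u0 _ _] := pu.
suff ker0 x : gb_sum x = 0 -> x = 0.
  by move=> x y /eqP; rewrite -subr_eq0 -linearB => /eqP/ker0/subr0_eq.
move=> x0; apply/ffunP => g; rewrite ffunE; apply: p_inj; rewrite raddf0.
apply: (mulIr (hcomp_unit gdA (uA g) (u0 g))); rewrite mul0r.
have /directv_sum_independent := hcomp_direct A.
move/(_ (fun h => p (x h) * u h)); apply=> // h _.
by apply/gb_hcompP; exists (x h).
Qed.

Lemma gb_sum_surj y : exists x, gb_sum x = y.
Proof.
have /memv_sumP[v vA ->] : y \in (\sum_g hcomp A g)%VS.
  by rewrite hcomp_full memvf.
have /choice[z zE] g : exists z, v g = p z * u g.
  by apply/gb_hcompP; apply: vA.
by exists [ffun g => z g]; apply: eq_bigr => g _; rewrite ffunE zE.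
Qed.

(** In coordinates the product involves only [s] and [a], so algebras with equal data multiply
    alike. *)
Lemma gb_sumM x y : gb_sum x * gb_sum y =
  gb_sum [ffun k => \sum_g x g * s g (y (g^-1 * k)%g) * a g (g^-1 * k)%g].
Proof.
have [_ _ _ up uM] := pu.
rewrite /gb_sum mulr_suml; under [RHS]eq_bigr do
  rewrite ffunE raddf_sum /= mulr_suml.
rewrite exchange_big /=; apply: eq_bigr => g _.
rewrite mulr_sumr (reindex_inj (mulgI g^-1%g)) /=; apply: eq_bigr => k _.
rewrite mulrA -[_ * u g * _]mulrA up !rmorphM -!mulrA uM mulKVg.
by rewrite !mulrA.
Qed.

Lemma gb_sum1 (x : {ffun gT -> D}) g :
  (forall h, h != g -> x h = 0) -> gb_sum x = p (x g) * u g.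
Proof.
move=> x0; rewrite /gb_sum (bigD1 g) //= big1 ?addr0 // => h /x0 ->.
by rewrite raddf0 mul0r.
Qed.

End Coordinates.

(** The isomorphism keeps coordinates: it is multiplicative by [gb_sumM], applied in both
    algebras. *)
Theorem graded_basis_iso A B (p : 'AHom(D, A)) (q : 'AHom(D, B)) s a u v :
  graded_division A -> graded_division B ->
  graded_basis p s a u -> graded_basis q s a v -> graded_iso A B.
Proof.
move=> gdA gdB pu qv.
pose P := linfun (gb_sum p u); pose Q := linfun (gb_sum q v).
have P0 : lker P == 0%VS.
  by apply/lker0P => x y; rewrite !lfunE; apply: (gb_sum_inj gdA pu).
have PK : cancel P P^-1%VF := lker0_lfunK P0.
pose f := (Q \o P^-1)%VF.
have fE x : f (gb_sum p u x) = gb_sum q v x.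
  by rewrite lfunE /=; have := PK x; rewrite !lfunE => ->.
have fM x y : f (x * y) = f x * f y.
  have [x' <-] := gb_sum_surj gdA pu x; have [y' <-] := gb_sum_surj gdA pu y.
  by rewrite (gb_sumM pu) !fE (gb_sumM qv).
have f_inj : injective f.
  move=> x y; have [x' <-] := gb_sum_surj gdA pu x.
  have [y' <-] := gb_sum_surj gdA pu y.
  by rewrite !fE => /(gb_sum_inj gdB qv) ->.
have f_surj y : exists x, f x = y.
  have [x <-] := gb_sum_surj gdB qv y.
  by exists (gb_sum p u x); rewrite fE.
(* f 1 is a left identity on the image of f, which is everything. *)
have f1 : f 1 = 1.
  by have [x xE] := f_surj 1; have := fM 1 x; rewrite mul1r xE mulr1 => <-.
have fA : ahom_in fullv f by apply/ahomP_tmp.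
exists (AHom fA); split; first exact: inj_surj_bijective.
have fmon g z : f (p z * u g) = q z * v g.
  pose x : {ffun gT -> D} := [ffun h => if h == g then z else 0].
  have x0 h : h != g -> x h = 0 by rewrite ffunE => /negPf ->.
  have xg : x g = z by rewrite ffunE eqxx.
  by have := fE x; rewrite !(gb_sum1 _ _ x0) xg.
move=> g; apply/vspaceP => y; apply/memv_imgP/(gb_hcompP gdB qv) => [[x]|[z ->]].
  by case/(gb_hcompP gdA pu) => z -> ->; exists z; rewrite /= fmon.
by exists (p z * u g); rewrite /= ?fmon //; apply/(gb_hcompP gdA pu); exists z.
Qed.

End GradedBasis.

(** * Crossed products *)

(** In general s_g s_h and s_gh differ by conjugation by a(g,h); with central values of [a], [s] can
    be a genuine action. *)
Record crossed_system (K : fieldType) (gT : finGroupType) (D : falgType K)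
    (s : gT -> 'AEnd(D)) (a : gT -> gT -> D) : Prop := CrossedSystem {
  crossed_act1 : forall z, s 1%g z = z;
  crossed_actM : forall g h z, s (g * h)%g z = s g (s h z);
  crossed_unit : forall g h, a g h \is a GRing.unit;
  crossed_central : forall g h z, a g h * z = z * a g h;
  crossed_cocycle : forall g h k,
    a g h * a (g * h)%g k = s g (a h k) * a g (h * k)%g
}.

Section CrossedProduct.
Variables (K : fieldType) (gT : finGroupType) (D : falgType K).
Variables (s : gT -> 'AEnd(D)) (a : gT -> gT -> D) (sa : crossed_system s a).

(* The function x stands for the sum of the x g u_g. *)
Definition crossed_of & crossed_system s a := {ffun gT -> D}.
Local Notation T := (crossed_of sa).
HB.instance Definition _ := Vector.on T.

Definition cp_mon (g : gT) (z : D) : T := [ffun h => if h == g then z else 0].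

(** Without normalisation u_1 u_1 = a(1,1) u_1, hence the scaling. *)
Definition cp_one : T := cp_mon 1%g (a 1%g 1%g)^-1.
Definition cp_mul (x y : T) : T :=
  [ffun k => \sum_g x g * s g (y (g^-1 * k)%g) * a g (g^-1 * k)%g].

(** This is the cocycle identity at (1, 1, g) with a(1,g) cancelled; the next fact comes likewise
    from (g, 1, 1). *)
Let a_1g g : a 1%g g = a 1%g 1%g.
Proof.
have := crossed_cocycle sa 1%g 1%g g; rewrite !mul1g (crossed_act1 sa) => /esym.
by apply: mulIr; apply: crossed_unit sa _ _.
Qed.

Let a_g1 g : a g 1%g = s g (a 1%g 1%g).
Proof.
have := crossed_cocycle sa g 1%g 1%g; rewrite !mulg1.
by apply: mulIr; apply: crossed_unit sa _ _.
Qed.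

(** Both sides become one sum over h and g. The terms agree by the cocycle identity at (h, h^-1 g,
    g^-1 k), once a central value of [a] is moved past the coefficient of z. *)
Fact cp_mulA : associative cp_mul.
Proof.
move=> x y z; apply/ffunP => k; rewrite !ffunE.
transitivity (\sum_h \sum_g x h * s h (y (h^-1 * g)%g) *
    a h (h^-1 * g)%g * s g (z (g^-1 * k)%g) * a g (g^-1 * k)%g).
  apply: eq_bigr => h _; rewrite ffunE rmorph_sum /= mulr_sumr mulr_suml.
  rewrite (reindex_inj (mulgI (h^-1)%g)) /=; apply: eq_bigr => g _.
  have := crossed_cocycle sa h (h^-1 * g)%g (g^-1 * k)%g.
  rewrite mulKVg -[(h^-1 * g * _)%g]mulgA mulKVg => E.
  rewrite invMg invgK -!mulgA mulKVg !rmorphM /= -(crossed_actM sa) mulKVg.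
  rewrite -!mulrA -E; congr (_ * (_ * _)).
  by rewrite !mulrA (crossed_central sa).
rewrite exchange_big /=; apply: eq_bigr => g _.
by rewrite ffunE !mulr_suml; apply: eq_bigr.
Qed.

Fact cp_mul1l : left_id cp_one cp_mul.
Proof.
move=> x; apply/ffunP => k; rewrite !ffunE (bigD1 1%g) //= big1 => [|g ng1].
  rewrite !ffunE eqxx addr0 invg1 mul1g a_1g (crossed_act1 sa).
  by rewrite -mulrA -(crossed_central sa) mulrA mulVr ?mul1r // (crossed_unit sa).
by rewrite !ffunE (negPf ng1) !mul0r.
Qed.

Fact cp_mul1r : right_id cp_one cp_mul.
Proof.
move=> x; apply/ffunP => k; rewrite !ffunE (bigD1 k) //= big1 => [|g ngk].
  rewrite !ffunE mulVg eqxx addr0 (a_g1 k) -mulrA -rmorphM.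
  by rewrite mulVr ?rmorph1 ?mulr1 // (crossed_unit sa).
rewrite !ffunE -(inj_eq (mulgI g)) mulKVg mulg1 eq_sym (negPf ngk).
by rewrite raddf0 mulr0 mul0r.
Qed.

Fact cp_mulDl : left_distributive cp_mul +%R.
Proof.
move=> x y z; apply/ffunP => k; rewrite !ffunE -big_split /=.
by apply: eq_bigr => g _; rewrite !ffunE !mulrDl.
Qed.

Fact cp_mulDr : right_distributive cp_mul +%R.
Proof.
move=> x y z; apply/ffunP => k; rewrite !ffunE -big_split /=.
by apply: eq_bigr => g _; rewrite !ffunE raddfD mulrDr mulrDl.
Qed.

Fact cp_one_neq0 : cp_one != 0.
Proof.
apply/eqP => /ffunP/(_ 1%g); rewrite !ffunE eqxx => e0.
by have := crossed_unit sa 1%g 1%g; rewrite -unitrV e0 unitr0.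
Qed.

HB.instance Definition _ := GRing.Zmodule_isNzRing.Build T
  cp_mulA cp_mul1l cp_mul1r cp_mulDl cp_mulDr cp_one_neq0.

Fact cp_scaleAl (k : K) (x y : T) : k *: (x * y) = k *: x * y.
Proof.
apply/ffunP => h; rewrite !ffunE scaler_sumr; apply: eq_bigr => g _.
by rewrite ffunE !scalerAl.
Qed.
Fact cp_scaleAr (k : K) (x y : T) : k *: (x * y) = x * (k *: y).
Proof.
apply/ffunP => h; rewrite !ffunE scaler_sumr; apply: eq_bigr => g _.
by rewrite ffunE linearZ /= -scalerAr scalerAl.
Qed.

HB.instance Definition _ := GRing.Lmodule_isLalgebra.Build K T cp_scaleAl.
HB.instance Definition _ := GRing.Lalgebra_isAlgebra.Build K T cp_scaleAr.
HB.instance Definition _ := Algebra_isFalgebra.Build K T.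

Fact cp_mon_linear g : linear (cp_mon g).
Proof.
move=> k x y; apply/ffunP => h; rewrite !ffunE.
by case: eqP; rewrite ?scaler0 ?addr0.
Qed.
HB.instance Definition _ g := GRing.isSemilinear.Build K D T _ (cp_mon g)
  (GRing.semilinear_linear (cp_mon_linear g)).

Lemma cp_mon_eq0 g z : (cp_mon g z == 0) = (z == 0).
Proof.
apply/eqP/eqP => [/ffunP/(_ g)|->]; last exact: linear0.
by rewrite !ffunE eqxx.
Qed.

Lemma cp_monM g h y z :
  cp_mon g y * cp_mon h z = cp_mon (g * h)%g (y * s g z * a g h).
Proof.
apply/ffunP => k; rewrite !ffunE (bigD1 g) //= big1 => [|x nxg].
  rewrite !ffunE eqxx addr0 -(inj_eq (mulgI g)) mulKVg.
  by case: eqP => [->|_]; rewrite ?mulKg // raddf0 mulr0 mul0r.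
by rewrite !ffunE (negPf nxg) !mul0r.
Qed.

Lemma cp_sumE (x : T) : x = \sum_g cp_mon g (x g).
Proof.
apply/ffunP => k; rewrite sum_ffunE (bigD1 k) //= big1 => [|g ngk].
  by rewrite ffunE eqxx addr0.
by rewrite ffunE eq_sym (negPf ngk).
Qed.

Definition cp_comp g : {vspace T} := limg (linfun (cp_mon g)).

Lemma cp_compP g (x : T) : reflect (exists z, x = cp_mon g z) (x \in cp_comp g).
Proof.
apply: (iffP memv_imgP) => [[z _ ->]|[z ->]]; first by exists z; rewrite lfunE.
by exists z; rewrite ?memvf ?lfunE.
Qed.

Fact cp_full : (\sum_g cp_comp g)%VS = fullv.
Proof.
apply/eqP; rewrite eqEsubv subvf /=; apply/subvP => x _; rewrite [x]cp_sumE.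
by apply: memv_sumr => g _; apply/cp_compP; exists (x g).
Qed.

Fact cp_direct : directv (\sum_g cp_comp g)%VS.
Proof.
apply/directv_sum_independent => u uT u0 g _.
have uE h : u h = cp_mon h (u h h).
  by have /cp_compP[z ->] := uT h isT; rewrite ffunE eqxx.
suff z : u g g = 0 by rewrite uE z linear0.
have := congr1 (fun x : T => x g) u0; rewrite sum_ffunE ffunE.
rewrite (bigD1 g) //= big1 ?addr0 // => h nhg.
by rewrite uE ffunE eq_sym (negPf nhg).
Qed.

Fact cp_compM g h : (cp_comp g * cp_comp h <= cp_comp (g * h)%g)%VS.
Proof.
apply/prodvP => x y /cp_compP[z ->] /cp_compP[t ->].
by rewrite cp_monM; apply/cp_compP; eexists.
Qed.

Definition crossed_product : gradedAlg K gT :=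
  GradedAlg cp_full cp_direct cp_compM.

Hypothesis divD : forall z : D, z != 0 -> z \is a GRing.unit.

Lemma crossed_product_division : graded_division crossed_product.
Proof.
split=> [g|g x /cp_compP[z ->]].
  apply/eqP => g0; have : cp_mon g 1 \in cp_comp g by apply/cp_compP; exists 1.
  by rewrite [cp_comp g]g0 memv0 cp_mon_eq0 oner_eq0.
rewrite cp_mon_eq0 => /divD Uz.
have Ua := crossed_unit sa.
(* With h = g^-1, (z u_g)(w u_h) = z s_g(w) a(g,h) u_1, to be equated with the unit a(1,1)^-1 u_1;
   solving for w gives the coefficient. *)
apply: (@right_inverse_unit _ _ _ (cp_mon g^-1%g
  (s g^-1%g (z^-1 * (a 1%g 1%g)^-1 * (a g g^-1%g)^-1)))).
rewrite cp_monM mulgV -(crossed_actM sa) mulgV (crossed_act1 sa).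
by rewrite !mulrA mulrV // mul1r -mulrA mulVr // mulr1.
Qed.

(** This is z -> z 1, the unit being a(1,1)^-1 u_1. *)
Definition cp_base : 'Hom(D, crossed_product) :=
  (linfun (cp_mon 1%g) \o amulr (a 1%g 1%g)^-1%R)%VF.

Lemma cp_baseE z : cp_base z = cp_mon 1%g (z / a 1%g 1%g).
Proof. by rewrite lfunE /= !lfunE. Qed.

Fact cp_base_is_ahom : ahom_in fullv cp_base.
Proof.
have Ua := crossed_unit sa 1%g 1%g.
apply/ahomP_tmp; split=> [|y z]; rewrite !cp_baseE ?mul1r //.
rewrite cp_monM mulg1 (crossed_act1 sa); congr cp_mon.
rewrite -!mulrA; congr (_ * _); rewrite mulVr // mulr1.
by apply: (mulrI Ua); rewrite mulVKr // mulrA (crossed_central sa) mulrK.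
Qed.

Definition cp_base_ahom : 'AHom(D, crossed_product) := AHom cp_base_is_ahom.

(** Every crossed system is thereby realised with its own [s] and [a], which makes the classifying
    maps surjective. *)
Lemma cp_graded_basis :
  graded_basis cp_base_ahom s a (fun g => cp_mon g 1 : crossed_product).
Proof.
have Ua := crossed_unit sa.
have aV z h : z / a 1%g 1%g * a 1%g h = z by rewrite a_1g divrK.
split; first split.
- move=> y z /eqP; rewrite -subr_eq0 -linearB /= cp_baseE cp_mon_eq0 => /eqP.
  by move/(congr1 ( *%R^~ (a 1%g 1%g))); rewrite divrK // mul0r => /subr0_eq.
- apply/vspaceP => x; apply/memv_imgP/cp_compP => [[z _ ->]|[z ->]].
    by rewrite /= cp_baseE; eexists.
  by exists (z * a 1%g 1%g); rewrite ?memvf //= cp_baseE mulrK.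
- by move=> g; apply/cp_compP; exists 1.
- by move=> g; rewrite cp_mon_eq0 oner_neq0.
- move=> g z; rewrite /= !cp_baseE !cp_monM mulg1 mul1g rmorph1 mul1r mulr1 aV.
  by rewrite (a_g1 g) -rmorphM divrK.
- by move=> g h; rewrite /= cp_baseE !cp_monM mul1g !rmorph1 !mulr1 !mul1r aV.
Qed.

End CrossedProduct.

(** * Central bases: real and quaternionic base *)

Section CentralBasis.
Variables (K : fieldType) (gT : finGroupType).
Implicit Types A B : gradedAlg K gT.
Implicit Types a b : gT -> gT -> K.

(** This form of a graded basis with trivial [s] mentions no embedding of the base, so the resulting
    class cannot depend on one. *)
Record central_basis A (u : gT -> A) a : Prop := CentralBasis {
  cb_mem : forall g, u g \in hcomp A g;
  cb_neq0 : forall g, u g != 0;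
  cb_comm : forall g x, x \in hcomp A 1%g -> u g * x = x * u g;
  cb_mul : forall g h, u g * u h = a g h *: u (g * h)%g
}.

(** Real and quaternionic bases need different arguments only for this property; everything else
    about them is uniform. *)
Definition centralized_components A := forall g, exists u : A,
  [/\ u \in hcomp A g, u != 0 & forall x, x \in hcomp A 1%g -> u * x = x * u].

(** Collecting the cocycles of all central bases avoids a choice of basis; [central_class_cls] shows
    that they fill exactly one cohomology class. *)
Definition central_class A : set (gT -> gT -> K) :=
  [set a | exists u : gT -> A, central_basis u a].

Lemma central_basis_change A (u : gT -> A) a b : central_basis u a ->
  cohomologous (@trivial_act K gT) a b -> exists v : gT -> A, central_basis v b.
Proof.
move=> [uA u0 uC uM] [l l0 bE]; exists (fun g => l g *: u g); split.
- by move=> g; rewrite memvZ.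
- by move=> g; rewrite scaler_eq0 (negPf (l0 g)) (negPf (u0 g)).
- by move=> g x Ax; rewrite -scalerAl -scalerAr uC.
- move=> g h; rewrite -scalerAl -scalerAr uM bE !scalerA /trivial_act.
  congr (_ *: _); rewrite [in RHS]mulrA divfK //; ring.
Qed.

(** Associativity of u_g u_h u_k, read off at u_ghk, is the cocycle identity. The values are nonzero
    because a product of units is not 0. *)
Lemma central_basis_cocycle A (u : gT -> A) a : graded_division A ->
  central_basis u a -> cocycle2 (@trivial_act K gT) a.
Proof.
move=> gdA [uA u0 uC uM]; have Uu g := hcomp_unit gdA (uA g) (u0 g).
split=> [g h|g h k].
  apply/eqP => a0; have := unitrMl (u g) (Uu h).
  by rewrite uM a0 scale0r unitr0 Uu.
apply/eqP; rewrite -subr_eq0 /trivial_act.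
have /eqP := mulrA (u g) (u h) (u k); rewrite !uM -scalerAl -scalerAr !uM.
rewrite !scalerA mulgA eq_sym -subr_eq0 -scalerBl scaler_eq0.
by rewrite (negPf (u0 _)) orbF.
Qed.

Section CentralBase.
Variables (D : falgType K).
Hypothesis D_central :
  forall z : D, (forall y, z * y = y * z) -> exists k, z = k%:A.

Lemma central_base_scalar A (p : 'AHom(D, A)) x : base_embedding p ->
  x \in hcomp A 1%g -> (forall y, y \in hcomp A 1%g -> x * y = y * x) ->
  exists k, x = k%:A.
Proof.
move=> [p_inj p_im]; rewrite -p_im => /memv_imgP[z _ ->] pzC.
case: (@D_central z) => [y|k ->]; last by exists k; rewrite rmorph_alg.
by apply: p_inj; rewrite !rmorphM pzC // memv_img ?memvf.
Qed.

(** The quotient of v_g by u_g lies in A_e and commutes with A_e, hence is a scalar l(g); these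
    scalars form the required cochain. *)
Lemma central_basis_cohomologous A (u v : gT -> A) a b :
  gda_over D A -> central_basis u a -> central_basis v b ->
  cohomologous (@trivial_act K gT) a b.
Proof.
move=> [gdA /has_baseP[p pA]] [uA u0 uC uM] [vA v0 vC vM].
have Uu g := hcomp_unit gdA (uA g) (u0 g).
have /choice[l lE] g : exists k, v g = k *: u g.
  have [||k kE] := @central_base_scalar A p (v g / u g) pA.
  - exact: mem_hcomp_div.
  - move=> y Ay; apply: (mulIr (Uu g)).
    by rewrite -[y * _ * _]mulrA divrK // -!mulrA -(uC g y Ay) mulKr // vC.
  by exists k; rewrite -[k *: _]mulr_algl -kE divrK.
have l0 g : l g != 0.
  by apply: contraNneq (v0 g) => lg0; rewrite lE lg0 scale0r.
exists l => // g h; apply/(mulIf (l0 (g * h)%g))/eqP.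
rewrite mulrA divfK // -subr_eq0 /trivial_act.
have := vM g h; rewrite !lE -scalerAl -scalerAr uM !scalerA => /eqP.
rewrite -subr_eq0 -scalerBl scaler_eq0 (negPf (u0 _)) orbF.
by rewrite !subr_eq0 => /eqP <-; apply/eqP; ring.
Qed.

Lemma central_class_cls A (u : gT -> A) a : gda_over D A -> central_basis u a ->
  central_class A = cls (@trivial_act K gT) a.
Proof.
move=> PA ua; apply/seteqP; split=> b /= => [[v vb]|].
  exact: central_basis_cohomologous PA ua vb.
exact: central_basis_change ua.
Qed.

(** This makes [graded_basis_iso] and transport along isomorphisms available for central bases,
    whatever the embedding [p]. *)
Lemma central_basisP A (p : 'AHom(D, A)) (u : gT -> A) a : base_embedding p ->
  central_basis u a <->
  graded_basis p (fun _ z => z) (fun g h => (a g h)%:A) u.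
Proof.
move=> pA; have [p_inj p_im] := pA; split=> [[uA u0 uC uM]|[_ uA u0 uC uM]].
  split=> // [g z|g h]; first by rewrite uC // -p_im memv_img ?memvf.
  by rewrite uM rmorph_alg mulr_algl.
split=> // [g x|g h]; last by rewrite uM rmorph_alg mulr_algl.
by rewrite -p_im => /memv_imgP[z _ ->]; rewrite uC.
Qed.

Hypothesis centralizing : forall A, gda_over D A -> centralized_components A.

(** For centralizing u_g, the element u_g u_h u_gh^-1 lies in A_e and commutes with A_e, so it is a
    scalar. *)
Lemma central_basis_exists A : gda_over D A ->
  exists (u : gT -> A) a, central_basis u a.
Proof.
move=> PA; have [gdA /has_baseP[p pA]] := PA.
have [u uP] := choice (centralizing PA).
have uA g : u g \in hcomp A g by case: (uP g).
have u0 g : u g != 0 by case: (uP g).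
have uC g x : x \in hcomp A 1%g -> u g * x = x * u g.
  by case: (uP g) => _ _; apply.
have Uu g := hcomp_unit gdA (uA g) (u0 g).
have /choice[a aE] (gh : gT * gT) :
    exists k, u gh.1 * u gh.2 = k *: u (gh.1 * gh.2)%g.
  case: gh => g h /=; have Ax := mem_hcompM (uA g) (uA h).
  have [||k kE] := @central_base_scalar A p (u g * u h / u (g * h)%g) pA.
  - exact: (mem_hcomp_div gdA (u0 (g * h)%g) Ax (uA (g * h)%g)).
  - move=> y Ay; apply: (mulIr (Uu (g * h)%g)).
    rewrite -[y * _ * _]mulrA divrK // -!mulrA -(uC (g * h)%g y Ay) mulKr //.
    by rewrite (uC h y Ay) !mulrA (uC g y Ay).
  by exists k; rewrite -[k *: _]mulr_algl -kE divrK.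
by exists u, (fun g h => a (g, h)); split=> // g h; have := aE (g, h).
Qed.

Lemma central_class_isoP A B : gda_over D A -> gda_over D B ->
  central_class A = central_class B <-> graded_iso A B.
Proof.
move=> PA PB; have [gdA /has_baseP[p pA]] := PA.
have [gdB /has_baseP[q qB]] := PB.
have [u [a ua]] := central_basis_exists PA.
split=> [AB|[f [f_bij f_im]]].
  (* The cocycle of [A] also occurs in [B], so both have graded bases with the same data. *)
  have [v vb] : central_class B a by rewrite -AB; exists u.
  have /(central_basisP _ _ pA) ua' := ua.
  have /(central_basisP _ _ qB) vb' := vb.
  exact: graded_basis_iso ua' vb'.
have /(central_basisP _ _ pA)/(graded_basis_transport f_bij f_im) fu := ua.
have /(central_basisP _ _ (gb_base fu)) fub := fu.
by rewrite (central_class_cls PA ua) (central_class_cls PB fub).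
Qed.

Theorem central_iso_classes : (forall z : D, z != 0 -> z \is a GRing.unit) ->
  iso_classes_bijection (@gda_over K gT D) (H2 (@trivial_act K gT)).
Proof.
move=> divD; exists central_class; split.
- move=> A PA; have [u [a ua]] := central_basis_exists PA.
  exists a; first by apply: central_basis_cocycle ua; case: PA.
  by rewrite (central_class_cls PA ua).
- exact: central_class_isoP.
- move=> _ [a [a0 aM] <-].
  (* The class is realised by letting the group act trivially on [D] and viewing the cocycle in the
     scalars of [D]. *)
  have sa : crossed_system (fun _ => \1%AF : 'AEnd(D)) (fun g h => (a g h)%:A).
    split=> [z|g h z|g h|g h z|g h k]; rewrite ?id_lfunE //.
    - by rewrite -in_algE rmorph_unit // unitfE.
    - by rewrite mulr_algl mulr_algr.
    - by rewrite -!in_algE -!rmorphM aM.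
  have gb := cp_graded_basis sa.
  have PA : gda_over D (crossed_product sa).
    split; first exact: crossed_product_division.
    by apply/has_baseP; exists (cp_base_ahom sa); case: gb.
  exists (crossed_product sa) => //.
  apply: (central_class_cls PA); apply/(central_basisP _ _ (gb_base gb)).
  case: gb => [pb uA u0 uC uM]; split=> [|g|g|g z|g h];
    [exact: pb|exact: uA|exact: u0| |exact: uM].
  by rewrite uC id_lfunE.
Qed.

End CentralBase.
End CentralBasis.

(** * Scalar base and twisted group algebras *)

Section ScalarBase.
Variable K : fieldType.

Definition scalar_map (D : falgType K) (k : K^o) : D := k *: 1.
Fact scalar_map_linear D : linear (@scalar_map D).
Proof. by move=> k x y; rewrite /scalar_map scalerDl scalerA. Qed.
HB.instance Definition _ (D : falgType K) :=
  GRing.isSemilinear.Build K K^o D _ (@scalar_map D)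
    (GRing.semilinear_linear (@scalar_map_linear D)).

Lemma scalar_algebra_iso (D : falgType K) :
  (forall x : D, exists k, x = k%:A) -> exists f : 'AHom(K^o, D), bijective f.
Proof.
move=> scalarD; pose f := linfun (@scalar_map D).
have fE (k : K^o) : f k = k%:A by rewrite lfunE.
have fA : ahom_in fullv f.
  apply/ahomP_tmp; split=> [|x y]; first by rewrite fE scale1r.
  by rewrite !fE -!in_algE rmorphM.
exists (AHom fA); apply: inj_surj_bijective => [x y|y]; rewrite /= ?fE.
  exact: (@fmorph_inj K D (in_alg D)).
by have [k ->] := scalarD y; exists k; rewrite fE.
Qed.

Lemma regular_central (z : K^o) : exists k : K, z = k%:A.
Proof. by exists z; rewrite /GRing.scale /= mulr1. Qed.

Variable gT : finGroupType.
Implicit Type A : gradedAlg K gT.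

Lemma scalar_has_base A :
  (forall x, x \in hcomp A 1%g -> exists k, x = k%:A) -> has_base K^o A.
Proof.
move=> scalarA; apply: scalar_algebra_iso => x.
have [k xE] := scalarA (vsval x) (subvsP x); exists k; apply: val_inj.
by rewrite [LHS]xE; congr (_ *: _); rewrite -(base_alg1 A).
Qed.

Lemma regular_centralizing A : gda_over K^o A -> centralized_components A.
Proof.
move=> [gdA /has_baseP[p [_ p_im]]] g.
have [u uA u0] := hcomp_neq0P gdA g; exists u; split=> // x.
rewrite -p_im => /memv_imgP[z _ ->]; have [k ->] := regular_central z.
by rewrite rmorph_alg mulr_algl mulr_algr.
Qed.

Section Twisted.
Variables (a : gT -> gT -> K) (ha : cocycle2 (@trivial_act K gT) a).
Local Notation A := (twisted_group_alg ha).

Lemma tw_basis_neq0 g : (tw_basis ha g : A) != 0.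
Proof.
apply/eqP => /ffunP/(_ g); rewrite !ffunE eqxx => /eqP.
by rewrite oner_eq0.
Qed.

Lemma twisted_base x : x \in hcomp A 1%g -> exists k, x = k%:A.
Proof.
have a0 : a 1%g 1%g != 0 by case: ha.
case/vlineP => k ->; exists (k * a 1%g 1%g).
by rewrite /GRing.one /= /tw_one scalerA mulfK.
Qed.

Lemma twisted_central_basis :
  central_basis (fun g => tw_basis ha g : A) a.
Proof.
split.
- by move=> g; apply: memv_line.
- exact: tw_basis_neq0.
- by move=> g x /twisted_base[k ->]; rewrite mulr_algl mulr_algr.
- exact: tw_basisM.
Qed.

Lemma twisted_gda : gda_over K^o A.
Proof.
have [a0 _] := ha.
split; last by apply: scalar_has_base; apply: twisted_base.
split=> [g|g x /vlineP[k ->]].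
  by apply/eqP => /vspaceP/(_ (tw_basis ha g));
    rewrite memv_line memv0 (negPf (tw_basis_neq0 g)).
rewrite scaler_eq0 negb_or => /andP[k0 _].
(* With h = g^-1, (k u_g)(c u_h) = k c a(g,h) u_1, and u_1 is a(1,1) times the unit; this determines
   c. *)
apply: (@right_inverse_unit _ _ _
  ((k * a g g^-1%g * a 1%g 1%g)^-1 *: tw_basis ha g^-1%g)).
rewrite -scalerAl -scalerAr tw_basisM mulgV /GRing.one /= /tw_one !scalerA.
by congr (_ *: _); field; rewrite !a0 k0.
Qed.

End Twisted.
End ScalarBase.

(** * Quaternionic base *)

Section QuaternionBase.
Variable R : realFieldType.
Local Notation H := (quat R).

Definition quat_i : H := Quat 0 1 0 0.
Definition quat_j : H := Quat 0 0 1 0.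

Lemma quatE (z : H) : z = (q1 z)%:A + qi z *: quat_i + qj z *: quat_j
  + qk z *: (quat_i * quat_j).
Proof. by case: z => a b c d; congr Quat => /=; ring. Qed.

Lemma quat_ii : quat_i * quat_i = -1.
Proof. by congr Quat => /=; ring. Qed.

Lemma quat_jj : quat_j * quat_j = -1.
Proof. by congr Quat => /=; ring. Qed.

Lemma quat_ji : quat_j * quat_i = - (quat_i * quat_j).
Proof. by congr Quat => /=; ring. Qed.

(** Commuting with j kills the coefficients of i and k, and commuting with i those of j and k. *)
Lemma quat_central (z : H) : (forall y, z * y = y * z) -> exists k, z = k%:A.
Proof.
move=> zC; exists (q1 z); have := zC quat_i; have := zC quat_j.
case: z {zC} => a b c d; rewrite /GRing.mul /= /quat_mul /= => -[_ Ej _ Ej'].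
case=> _ _ Ei Ei'; congr Quat => /=; lra.
Qed.

Lemma quat_neq0_unit (z : H) : z != 0 -> z \is a GRing.unit.
Proof.
case: z => a b c d z0; pose n := a ^+ 2 + b ^+ 2 + c ^+ 2 + d ^+ 2.
have n0 : n != 0.
  apply: contra_neq z0; rewrite /n => n0.
  have : [/\ a ^+ 2 = 0, b ^+ 2 = 0, c ^+ 2 = 0 & d ^+ 2 = 0].
    move: (sqr_ge0 a) (sqr_ge0 b) (sqr_ge0 c) (sqr_ge0 d) => a0 b0 c0 d0.
    by split; lra.
  by case=> /eqP + /eqP + /eqP + /eqP;
    rewrite !sqrf_eq0 => /eqP -> /eqP -> /eqP -> /eqP ->.
(* The inverse is the conjugate divided by the norm. *)
apply: (@right_inverse_unit _ _ _ (n^-1 *: Quat a (- b) (- c) (- d))).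
by congr Quat => /=; move: n0; rewrite /n => n0; field.
Qed.

(* Averaging over the conjugations by 1 and i gives elements commuting with i;
   the averages of x and x t cannot both vanish. *)
Lemma conj_average (A : falgType R) (i t x : A) :
  i * i = -1 -> t * i = - (i * t) -> t * t = -1 -> x != 0 ->
  exists w, [/\ w = 1 \/ w = t, x * w - i * (x * w) * i != 0 &
    i * (x * w - i * (x * w) * i) = (x * w - i * (x * w) * i) * i].
Proof.
move=> ii ti tt x0.
have comm y : i * (y - i * y * i) = (y - i * y * i) * i.
  rewrite mulrBr mulrBl !mulrA ii -[i * y * i * i]mulrA ii.
  by rewrite mulN1r mulNr mulrN1 !opprK addrC.
have [e1|n1] := eqVneq (x * 1 - i * (x * 1) * i) 0; last first.
  by exists 1; split=> //; left.
have [e2|n2] := eqVneq (x * t - i * (x * t) * i) 0; last first.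
  by exists t; split=> //; right.
case/eqP: x0; move: e1 e2; rewrite mulr1 => /subr0_eq xE.
have -> : i * (x * t) * i = - (x * t).
  by rewrite -!mulrA ti !mulrN !mulrA -xE.
rewrite opprK -mulr2n -scaler_nat => /eqP.
rewrite scaler_eq0 pnatr_eq0 => /eqP/(congr1 ( *%R^~ t)).
by rewrite -mulrA tt mulrN1 mul0r => /eqP; rewrite oppr_eq0 => /eqP.
Qed.

Variable gT : finGroupType.
Implicit Type A : gradedAlg R gT.

(** Averaging first over conjugation by i and then over conjugation by j gives a nonzero element
    commuting with both; the second averaging must not destroy commutation with i. *)
Lemma quat_centralizing A : gda_over H A -> centralized_components A.
Proof.
move=> [gdA /has_baseP[p [_ p_im]]] g.
have pA z : p z \in hcomp A 1%g by rewrite -p_im memv_img ?memvf.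
have mem1 x y : x \in hcomp A 1%g -> y \in hcomp A g -> x * y \in hcomp A g.
  by move=> Ax Ay; rewrite -[g]mul1g mem_hcompM.
have mem2 x y : x \in hcomp A g -> y \in hcomp A 1%g -> x * y \in hcomp A g.
  by move=> Ax Ay; rewrite -[g]mulg1 mem_hcompM.
have memJ i x : i \in hcomp A 1%g -> x \in hcomp A g ->
    x - i * x * i \in hcomp A g.
  by move=> Ai Ax; rewrite rpredB // mem2 ?mem1.
pose i := p quat_i; pose j := p quat_j.
have ii : i * i = -1 by rewrite -rmorphM quat_ii rmorphN1.
have jj : j * j = -1 by rewrite -rmorphM quat_jj rmorphN1.
have ji : j * i = - (i * j) by rewrite -!rmorphM quat_ji rmorphN.
have ij : i * j = - (j * i) by rewrite ji opprK.
have [x xA x0] := hcomp_neq0P gdA g.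
have [w [wE]] := conj_average ii ji jj x0.
have wA : w \in hcomp A 1%g by case: wE => ->; rewrite ?mem1_hcomp1 ?pA.
set y := x * w - _ => y0 yi.
have yA : y \in hcomp A g by rewrite memJ ?pA ?mem2.
clearbody y; clear wE wA w.
have [v [vE]] := conj_average jj ij ii y0.
have vA : v \in hcomp A 1%g by case: vE => ->; rewrite ?mem1_hcomp1 ?pA.
set u := y * v - _ => u0 uj; exists u.
have uA : u \in hcomp A g by rewrite memJ ?pA ?mem2.
(* The correcting factor v is 1 or i, so it commutes with i. *)
have yvi : i * (y * v) = y * v * i.
  by case: vE => ->; rewrite ?mulr1 // mulrA yi.
(* Conjugation by j preserves the centralizer of i: moving i past the two factors j changes its sign
   twice. *)
have key z : i * z = z * i -> i * (j * z * j) = j * z * j * i.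
  move=> iz; rewrite -[RHS]mulrA ji mulrN [in RHS]mulrA -[j * z * i]mulrA -iz.
  by rewrite [in RHS]mulrA ji !mulNr opprK !mulrA.
have ui : i * u = u * i by rewrite /u mulrBr mulrBl yvi key.
clearbody u.
split=> // z; rewrite -p_im => /memv_imgP[q _ ->].
(* The elements 1, i, j, ij span the quaternions, so commuting with i and j is enough. *)
rewrite (quatE q) !linearD !linearZ /= rmorphM rmorph1 -/i -/j.
rewrite !mulrDl !mulrDr -!scalerAl -!scalerAr mulr1 mul1r -ui -uj.
by rewrite mulrA -ui -!mulrA -uj.
Qed.

End QuaternionBase.

(** * Frobenius' theorem *)

(** Only surjectivity needs checking: a nonzero element of the kernel would be a unit, and units map
    to units. *)
Lemma division_ahom_bijective (K : fieldType) (D E : falgType K)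
    (f : 'AHom(D, E)) :
  (forall z : D, z != 0 -> z \is a GRing.unit) ->
  (forall y, exists x, f x = y) ->
  bijective f.
Proof.
move=> divD; apply: inj_surj_bijective => x y /eqP.
rewrite -subr_eq0 -raddfB => /eqP fxy0; apply/eqP; rewrite -subr_eq0.
apply: contraT => /divD/(rmorph_unit f); rewrite /= fxy0.
by rewrite unitr0.
Qed.

Section ComplexAlgebra.
Variable R : rcfType.
Local Notation C := (Rcomplex R).

Definition Rcomplex_i : C := Complex 0 1.

Lemma RcomplexE (z : C) :
  z = (complex.Re z)%:A + complex.Im z *: Rcomplex_i.
Proof.
by case: z => a b; congr Complex; rewrite /= ?mulr0 ?mulr1 ?addr0 ?add0r.
Qed.

Lemma Rcomplex_ii : Rcomplex_i * Rcomplex_i = -1.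
Proof. by congr Complex => /=; ring. Qed.

Section FromRoot.
Variables (D : falgType R) (i : D).
Hypothesis ii : i * i = -1.

Definition complex_eval (z : C) : D := (complex.Re z)%:A + complex.Im z *: i.

Fact complex_eval_linear : linear complex_eval.
Proof.
move=> k [a b] [c d]; rewrite /complex_eval /= !scalerDl -!scalerA scalerDr.
by rewrite addrACA.
Qed.
HB.instance Definition _ := GRing.isSemilinear.Build R C D _ complex_eval
  (GRing.semilinear_linear complex_eval_linear).

Lemma complex_eval_ahom :
  exists f : 'AHom(C, D), forall z, f z = (complex.Re z)%:A + complex.Im z *: i.
Proof.
have fA : ahom_in fullv (linfun complex_eval).
  apply/ahomP_tmp; split=> [|[a b] [c d]]; rewrite !lfunE /complex_eval /=.
    by rewrite -[LHS]/(1%:A + 0 *: i) scale1r scale0r addr0.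
  rewrite -[LHS]/((a * c - b * d)%:A + (a * d + b * c) *: i).
  rewrite -[RHS]/((a%:A + b *: i) * (c%:A + d *: i)).
  rewrite mulrDl !mulrDr mulr_algl mulr_algr -[a%:A * _]scalerAl mul1r.
  rewrite -scalerAl -scalerAr ii !scalerDl !scalerA scaleNr !scalerN.
  by rewrite [c * b]mulrC addrACA [- _ + _]addrC.
by exists (AHom fA) => z; rewrite lfunE.
Qed.
End FromRoot.

Section QuaternionEval.
Variables (D : falgType R) (i j : D).
Hypotheses (ii : i * i = -1) (jj : j * j = -1) (ji : j * i = - (i * j)).

(** With the effect of i, j and ij on these coordinates known, multiplicativity of [quat_eval]
    reduces to four identities in [R]. *)
Let lin (a b c d : R) : D := a%:A + b *: i + c *: j + d *: (i * j).
Definition quat_eval (z : quat R) : D := lin (q1 z) (qi z) (qj z) (qk z).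

Let linD a b c d a' b' c' d' :
  lin a b c d + lin a' b' c' d' = lin (a + a') (b + b') (c + c') (d + d').
Proof.
rewrite /lin !scalerDl; do 2!(rewrite addrACA; congr (_ + _)).
exact: addrACA.
Qed.

Let linZ k a b c d : k *: lin a b c d = lin (k * a) (k * b) (k * c) (k * d).
Proof. by rewrite /lin !scalerDr !scalerA. Qed.

Let lin_mul1 a b c d : i * lin a b c d = lin (- b) a (- d) c.
Proof.
rewrite /lin !mulrDr mulr_algr -!scalerAr mulrA ii mulN1r !scalerN !scaleNr.
by rewrite addrAC [_ *: i + _]addrC.
Qed.

Let lin_mulj a b c d : j * lin a b c d = lin (- c) d a (- b).
Proof.
rewrite /lin !mulrDr mulr_algr -!scalerAr jj mulrA ji mulNr -mulrA jj mulrN1.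
by rewrite opprK !scalerN !scaleNr -addrA addrC addrA.
Qed.

Let lin_mulk a b c d : i * j * lin a b c d = lin (- d) (- c) b a.
Proof.
rewrite -mulrA lin_mulj lin_mul1.
by rewrite /lin !opprK.
Qed.

Fact quat_eval_linear : linear quat_eval.
Proof. by move=> k x y; rewrite /quat_eval linZ linD. Qed.
HB.instance Definition _ := GRing.isSemilinear.Build R (quat R) D _ quat_eval
  (GRing.semilinear_linear quat_eval_linear).

Lemma quat_eval_ahom : exists f : 'AHom(quat R, D), forall z, f z =
  (q1 z)%:A + qi z *: i + qj z *: j + qk z *: (i * j).
Proof.
have fA : ahom_in fullv (linfun quat_eval).
  apply/ahomP_tmp; split=> [|[a b c d] y]; rewrite !lfunE.
    by rewrite /= /quat_eval /lin /= scale1r !scale0r !addr0.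
  rewrite /= /quat_eval [lin a b c d]/lin !mulrDl -!scalerAl mul1r.
  rewrite lin_mul1 lin_mulj lin_mulk !linZ !linD /=.
  by congr (lin _ _ _ _); ring.
by exists (AHom fA) => z; rewrite lfunE.
Qed.
End QuaternionEval.

Section Frobenius.
Variable D : falgType R.
Hypothesis divD : forall x : D, x != 0 -> x \is a GRing.unit.

Lemma division_mulf_eq0 (x y : D) : x * y = 0 -> x = 0 \/ y = 0.
Proof.
have [->|/divD Ux] := eqVneq x 0; first by left.
by move=> xy0; right; apply: (mulrI Ux); rewrite mulr0.
Qed.

(** The powers of x up to the dimension of [D] are one too many to be independent. *)
Lemma annihilating_poly (x : D) :
  exists2 p : {poly R}, p != 0 & horner_alg x p = 0.
Proof.
pose X : (\dim {:D}).+1.-tuple D := [tuple x ^+ i | i < (\dim {:D}).+1].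
have nfX : ~~ free X.
  apply/negP => /eqP fX; have := dimvS (subvf <<X>>%VS).
  by rewrite fX size_tuple ltnn.
have [k [k0 [i ki]]] : exists k : 'I_(\dim {:D}).+1 -> R,
    \sum_i k i *: X`_i = 0 /\ exists i, k i != 0.
  apply: contra_notP (negP nfX) => nk; apply/freeP => k k0 i.
  by apply: contra_notP nk => /eqP ki; exists k; split=> //; exists i.
pose p := \poly_(j < (\dim {:D}).+1) k (inord j).
exists p.
  apply: contraNneq ki => p0.
  have := coef_poly (\dim {:D}).+1 (fun j => k (inord j)) i.
  by rewrite -/p p0 coef0 ltn_ord inord_val => <-.
rewrite /p poly_def raddf_sum -[RHS]k0; apply: eq_bigr => j _ /=.
rewrite linearZ /= rmorphXn /= horner_algX inord_val.
by rewrite -[X`_j]tnth_nth tnth_mktuple mulr_algl.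
Qed.

(* Over R[i] an annihilating polynomial p of x splits; the product of the real
   quadratics (X - Re c)^2 + (Im c)^2 over its roots c is a multiple of p. *)
Lemma real_quadratic (x : D) :
  exists a b : R, (x - a%:A) * (x - a%:A) = - (b ^+ 2)%:A.
Proof.
have [p p0 px0] := annihilating_poly x.
pose q (c : R[i]) : {poly R} :=
  ('X - (complex.Re c)%:P) ^+ 2 + ((complex.Im c) ^+ 2)%:P.
have [r rE] := closed_field_poly_normal (map_poly (real_complex R) p).
have dvd_pq : p %| \prod_(c <- r) q c.
  rewrite -(dvdp_map (real_complex R)) rE rmorph_prod /=.
  rewrite dvdpZl ?lead_coef_eq0 ?map_poly_eq0 //.
  elim: r {rE} => [|c r IHr]; rewrite ?big_nil ?big_cons ?dvdpp //.
  apply: dvdp_mul IHr; rewrite dvdp_XsubCl /root /q.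
  rewrite rmorphD rmorphXn /= rmorphB /= !map_polyC map_polyX !hornerE.
  rewrite [X in X - _]complexE addrAC subrr add0r exprMn sqr_i mulN1r.
  by rewrite -rmorphXn addNr.
have : horner_alg x (\prod_(c <- r) q c) = 0.
  have /dvdpP[s ->] := dvd_pq; by rewrite rmorphM /= px0 mulr0.
(* As [D] has no zero divisors, one of the quadratic factors already vanishes at x. *)
rewrite rmorph_prod /=; elim: r {rE dvd_pq} => [|c r IHr].
  by rewrite big_nil => /eqP; rewrite oner_eq0.
rewrite big_cons => /division_mulf_eq0[|/IHr//].
rewrite /q rmorphD rmorphXn /= rmorphB /= horner_algX !horner_algC => /eqP.
by rewrite addr_eq0 expr2 => /eqP; exists (complex.Re c), (complex.Im c).
Qed.

(** For a suitable real a, y = x - a commutes with i and has y^2 = -b^2 = (b i)^2, so (y - b i)(y +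
    b i) = 0. *)
Lemma centralizer_root (i x : D) : i * i = -1 -> i * x = x * i ->
  exists a b : R, x = a%:A + b *: i.
Proof.
move=> ii ix; have [a [b]] := real_quadratic x.
set y := x - a%:A => yy.
have iy : i * y = y * i by rewrite mulrBl mulrBr ix mulr_algr mulr_algl.
have xE : x = y + a%:A by rewrite subrK.
clearbody y; have : (y - b *: i) * (y + b *: i) = 0.
  rewrite mulrDl !mulrDr yy !mulNr -!scalerAl -!scalerAr iy ii scalerA.
  by rewrite -expr2 scalerN opprK addrA addrK addNr.
case/division_mulf_eq0 => /eqP; rewrite ?subr_eq0 ?addr_eq0 => /eqP yE.
  by exists a, b; rewrite xE yE addrC.
by exists a, (- b); rewrite xE yE scaleNr addrC.
Qed.

(** If [D] is not [R], a real quadratic yields i with i^2 = -1. If i is central, [D] is its own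
    centralizer of i, a copy of C. Otherwise an element anticommuting with i, suitably scaled,
    serves as j. *)
Theorem frobenius :
  [\/ exists f : 'AHom(R^o, D), bijective f,
      exists f : 'AHom(quat R, D), bijective f |
      exists f : 'AHom(C, D), bijective f].
Proof.
have [scalarD|] := pselect (forall x : D, exists k, x = k%:A).
  by constructor 1; apply: scalar_algebra_iso.
move=> /existsNP[x /forallNP xns].
have [a [b ab]] := real_quadratic x.
have b0 : b != 0.
  apply/eqP => b0; move: ab; rewrite b0 expr0n /= scale0r oppr0.
  by case/division_mulf_eq0 => /subr0_eq; apply: xns.
pose i := b^-1 *: (x - a%:A).
have ii : i * i = -1.
  rewrite -scalerAl -scalerAr ab scalerA scalerN scalerA.
  by rewrite -expr2 -exprMn mulVf // expr1n scale1r.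
clearbody i; have [iC|] := pselect (forall y : D, i * y = y * i).
  constructor 3; have [f fE] := complex_eval_ahom ii; exists f.
  apply: division_ahom_bijective => [z|y]; first by rewrite unitfE.
  have [c [d ->]] := centralizer_root ii (iC y).
  by exists (Complex c d); rewrite fE.
(* This y is the part of y0 anticommuting with i, up to a factor 2; it vanishes only if y0 commutes
   with i. *)
move=> /existsNP[y0 iy0]; pose y := y0 + i * y0 * i.
have iy : i * y = - (y * i).
  rewrite mulrDr mulrDl !mulrA ii -[i * y0 * i * i]mulrA ii mulN1r mulNr mulrN1.
  by rewrite opprD opprK addrC.
have y_neq0 : y != 0.
  apply/eqP => yE0; apply: iy0; have := congr1 ( *%R i) yE0.
  rewrite mulrDr mulr0 !mulrA ii mulN1r mulNr => /eqP.
  by rewrite subr_eq0 => /eqP.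
clearbody y; have y_ni : i * y <> y * i.
  rewrite iy => /eqP; rewrite eq_sym -addr_eq0 -mulr2n -scaler_nat.
  rewrite scaler_eq0 pnatr_eq0 /= => /eqP /(congr1 ( *%R^~ i)).
  by rewrite -mulrA ii mulrN1 mul0r => /eqP; rewrite oppr_eq0 (negPf y_neq0).
have iyy : i * (y * y) = y * y * i.
  by rewrite mulrA iy mulNr -[y * i * y]mulrA iy mulrN opprK mulrA.
have [c [d cd]] := centralizer_root ii iyy.
(* y commutes with its square c + d i but anticommutes with i. *)
have d0 : d = 0.
  have : y * (y * y) = y * y * y by rewrite mulrA.
  rewrite cd mulrDl mulrDr mulr_algl mulr_algr -scalerAl -scalerAr => /addrI.
  rewrite iy scalerN => /eqP; rewrite -addr_eq0 -mulr2n -scaler_nat.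
  rewrite scaler_eq0 pnatr_eq0 /= scaler_eq0 => /orP[/eqP //|/eqP yi0].
  by case: y_ni; rewrite iy yi0 oppr0.
rewrite d0 scale0r addr0 in cd.
(* If c had a real square root, y would be plus or minus that root and would commute with i. *)
have c_lt0 : c < 0.
  rewrite ltNge; apply/negP => c_ge0; pose s := Num.sqrt c.
  have : (y - s%:A) * (y + s%:A) = 0.
    rewrite mulrDl !mulrDr cd !mulNr !mulr_algl mulr_algr scalerA.
    rewrite -expr2 sqr_sqrtr //.
    by rewrite addrA addrK addrN.
  case/division_mulf_eq0 => /eqP; rewrite ?subr_eq0 ?addr_eq0 => /eqP yE;
    by case: y_ni; rewrite yE ?mulrN ?mulNr mulr_algl mulr_algr.
pose t := Num.sqrt (- c); have t0 : t != 0.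
  by rewrite sqrtr_eq0 -ltNge oppr_gt0.
have tt : t ^+ 2 = - c by rewrite sqr_sqrtr // oppr_ge0 ltW.
pose j := t^-1 *: y.
have jj : j * j = -1.
  rewrite -scalerAl -scalerAr cd !scalerA -expr2 exprVn tt invrN.
  by rewrite mulNr mulVf ?scaleN1r // lt_eqF.
have ji : j * i = - (i * j).
  by rewrite -scalerAl -scalerAr iy scalerN opprK.
clearbody j; constructor 2; have [f fE] := quat_eval_ahom ii jj ji; exists f.
apply: division_ahom_bijective => [z|z]; first exact: quat_neq0_unit.
(* Twice z splits into z1 commuting with i and z2 anticommuting with it. Then z2 j commutes with i,
   so z1 and z2 j both lie in R + R i. *)
pose z1 := z - i * z * i; pose z2 := z + i * z * i.
have iz1 : i * z1 = z1 * i.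
  rewrite mulrBr mulrBl !mulrA ii -[i * z * i * i]mulrA ii.
  by rewrite mulN1r mulNr mulrN1 !opprK addrC.
have iz2 : i * z2 = - (z2 * i).
  rewrite mulrDr mulrDl !mulrA ii -[i * z * i * i]mulrA ii mulN1r mulNr mulrN1.
  by rewrite opprD opprK addrC.
have zE : z1 + z2 = 2 *: z.
  by rewrite addrACA addNr addr0 -mulr2n scaler_nat.
clearbody z1 z2; have iz2j : i * (z2 * j) = z2 * j * i.
  by rewrite mulrA iz2 mulNr -!mulrA ji mulrN.
have [c1 [d1 e1]] := centralizer_root ii iz1.
have [c2 [d2 e2]] := centralizer_root ii iz2j.
have z2E : z2 = - (c2 *: j + d2 *: (i * j)).
  by rewrite scalerAl -mulr_algl -mulrDl -e2 -mulrA jj mulrN1 opprK.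
exists (2^-1 *: Quat c1 d1 (- c2) (- d2)); rewrite linearZ /= fE /=.
rewrite !scaleNr -addrA -opprD -z2E -e1 zE.
by rewrite scalerA mulVf ?scale1r ?pnatr_eq0.
Qed.

End Frobenius.
End ComplexAlgebra.

Theorem graded_division_base (R : rcfType) (gT : finGroupType)
    (A : gradedAlg R gT) : graded_division A ->
  [\/ has_base R^o A, has_base (quat R) A | has_base (Rcomplex R) A].
Proof.
move=> gdA; apply: frobenius => x x0; apply: vsval_unitr.
exact: (hcomp_unit gdA (subvsP x)).
Qed.

(** * Complex base *)

Section ComplexAutomorphisms.
Variable R : rcfType.
Local Notation C := (Rcomplex R).
Implicit Type f : 'AEnd(C).

Fact conj_is_ahom : ahom_in fullv (linfun (@conjc R : C -> C)).
Proof.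
apply/ahomP_tmp; split=> [|x y]; rewrite !lfunE; first exact: conjc1.
exact: (@rmorphM R[i] R[i] (@conjc R) x y).
Qed.

Definition conj_aend : 'AEnd(C) := AHom conj_is_ahom.

Lemma conj_aendE (z : C) : conj_aend z = conjc z.
Proof. by rewrite lfunE. Qed.

Lemma Rcomplex_sqrtN1 (w : C) : w * w = -1 ->
  w = Rcomplex_i R \/ w = conj_aend (Rcomplex_i R).
Proof.
have -> : conj_aend (Rcomplex_i R) = - Rcomplex_i R.
  by rewrite conj_aendE; congr Complex; rewrite /= oppr0.
rewrite -(@Rcomplex_ii R) => /eqP; rewrite -!expr2 eqf_sqr.
by case/orP => /eqP; [left|right].
Qed.

Lemma aend_ext f f' : (forall z, f z = f' z) -> f = f'.
Proof. by move=> ff'; apply/val_inj/lfunP. Qed.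

Lemma eq_on_i (A : falgType R) (f f' : 'AHom(C, A)) :
  f (Rcomplex_i R) = f' (Rcomplex_i R) -> forall z, f z = f' z.
Proof.
by move=> fi z; rewrite (RcomplexE z) !linearD !linearZ /= !rmorph1 fi.
Qed.

(** An endomorphism is determined by the image of i, which must be a square root of -1. *)
Lemma aend_cases f : f = \1%AF \/ f = conj_aend.
Proof.
have [|fi|fi] := @Rcomplex_sqrtN1 (f (Rcomplex_i R)).
- by rewrite -rmorphM Rcomplex_ii rmorphN1.
- by left; apply/aend_ext/eq_on_i; rewrite fi id_lfunE.
- by right; apply/aend_ext/eq_on_i.
Qed.

Lemma conj_aend_neq1 : conj_aend <> \1%AF.
Proof.
move=> /(congr1 (fun f : 'AEnd(C) => f (Rcomplex_i R))).
rewrite id_lfunE conj_aendE => -[] /eqP.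
by rewrite eq_sym -addr_eq0 -mulr2n pnatr_eq0.
Qed.

Lemma conj_aendK (z : C) : conj_aend (conj_aend z) = z.
Proof. by rewrite !conj_aendE conjcK. Qed.

(** Used to see that conjugating the identification of A_e with C leaves the action unchanged. *)
Lemma aend_comm f f' (z : C) : f (f' z) = f' (f z).
Proof.
by case: (aend_cases f) => ->; case: (aend_cases f') => ->; rewrite ?id_lfunE.
Qed.

End ComplexAutomorphisms.

(** * Actions on C and subgroups of index 2 *)

Section AutActions.
Variables (R : rcfType) (gT : finGroupType).
Local Notation C := (Rcomplex R).
Implicit Type eta : gT -> 'AEnd(C).

Lemma aut_actionM eta : is_aut_action eta ->
  forall g h z, eta (g * h)%g z = eta g (eta h z).
Proof. by case=> _ etaM g h z; rewrite etaM comp_lfunE. Qed.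

Lemma aut_action_kerP eta g : reflect (eta g = \1%AF) (g \in aut_action_ker eta).
Proof. by rewrite inE; apply: eqP. Qed.

Lemma aut_action_ker_group eta : is_aut_action eta ->
  group_set (aut_action_ker eta).
Proof.
move=> etaA; apply/group_setP; split; first by apply/aut_action_kerP; case: etaA.
move=> g h /aut_action_kerP g1 /aut_action_kerP h1; apply/aut_action_kerP.
by apply: aend_ext => z; rewrite aut_actionM // g1 h1 !id_lfunE.
Qed.

(** Right multiplication by an element g0 acting as conjugation exchanges the kernel and its
    complement, since two conjugations cancel; they have equal size. *)
Lemma aut_action_ker_index eta : is_aut_action eta ->
  ~ trivial_aut_action eta -> #|[set: gT]%SET : aut_action_ker eta|%g = 2%N.
Proof.
move=> etaA /existsNP[g0 g0N]; have [g1|gc] := aend_cases (eta g0) => //.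
pose N := Group (aut_action_ker_group etaA).
have cN h : (h \in ~: N) = (h * g0 \in N)%g.
  rewrite inE; apply/negP/aut_action_kerP => [hN|hg].
    case: (aend_cases (eta h)) => [h1|hc].
      by case: hN; apply/aut_action_kerP.
    by apply: aend_ext => z; rewrite aut_actionM // hc gc conj_aendK id_lfunE.
  move=> /aut_action_kerP h1; apply: (@conj_aend_neq1 R); rewrite -hg.
  by apply: aend_ext => z; rewrite aut_actionM // h1 id_lfunE gc.
have cardN : #|~: N| = #|N|.
  rewrite -(card_rcoset N g0^-1%g); apply: eq_card => h.
  by rewrite cN mem_rcoset invgK.
have := Lagrange (finset.subsetT N).
rewrite finset.cardsT -(finset.cardsC N) cardN addnn -muln2.
by move/eqP; rewrite eqn_pmul2l ?cardG_gt0 // => /eqP.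
Qed.

(** The coset g N is the whole complement of N, so g h outside N would force h into N. *)
Lemma index2_mulg (N : {group gT}) g h : #|[set: gT]%SET : N|%g = 2%N ->
  g \notin N -> h \notin N -> (g * h)%g \in N.
Proof.
move=> iN gN hN; apply: contraNT hN => ghN.
have sub : (g *: N \subset ~: N)%g.
  apply/fintype.subsetP => x; rewrite mem_lcoset inE; apply: contraL => xN.
  by rewrite groupMr // groupV.
have /eqP gNE : (g *: N == ~: N)%g.
  rewrite eqEcard sub card_lcoset -(leq_add2l #|N|) finset.cardsC -finset.cardsT.
  by rewrite -(Lagrange (finset.subsetT N)) iN addnn muln2 leqnn.
have : (g * h)%g \in ~: N by rewrite inE.
by rewrite -gNE mem_lcoset mulKg.
Qed.

(** With only two automorphisms available, an action is known from its kernel. Conversely, acting by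
    conjugation exactly outside N is a homomorphism by [index2_mulg]. *)
Lemma aut_action_bij :
  set_bij [set eta | is_aut_action eta /\ ~ trivial_aut_action eta]
    (@index2_subgroups gT) (@aut_action_ker R gT).
Proof.
split.
- move=> eta [etaA etaN] /=.
  by split; [exact: aut_action_ker_group|exact: aut_action_ker_index].
- move=> eta eta' _ _ /setP ker_eq; apply: funext => g.
  have := ker_eq g; rewrite !inE.
  case: (aend_cases (eta g)) => ->; case: (aend_cases (eta' g)) => -> //.
    by rewrite eqxx => /esym/eqP.
  by rewrite eqxx => /eqP.
- move=> N [gN iN]; pose G := Group gN.
  pose eta g : 'AEnd(C) := if g \in G then \1%AF else conj_aend R.
  have kerE : aut_action_ker eta = N.
    apply/setP => g; rewrite inE /eta -[N]/(G : {set gT}).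
    case: (g \in G); first by rewrite eqxx.
    by apply/negbTE/eqP; apply: conj_aend_neq1.
  exists eta => //; split.
    split=> [|g h]; first by rewrite /eta group1.
    apply: aend_ext => z; rewrite comp_lfunE /= /eta.
    have [gG|gG] := boolP (g \in G); first by rewrite groupMl // id_lfunE.
    have [hG|hG] := boolP (h \in G).
      by rewrite groupMr // (negPf gG) id_lfunE.
    by rewrite (index2_mulg (N := G)) // conj_aendK id_lfunE.
  (* The trivial action has a kernel of index 1, not 2. *)
  move=> eta1; move: iN; rewrite -kerE.
  have -> : aut_action_ker eta = [set: gT]%SET.
    by apply/setP => g; rewrite !inE eta1 eqxx.
  by rewrite indexgg.
Qed.

End AutActions.

(** * Classification over a complex base *)

Section ComplexBase.
Variables (R : rcfType) (gT : finGroupType).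
Local Notation C := (Rcomplex R).
Implicit Types (A B : gradedAlg R gT) (eta : gT -> 'AEnd(C)).

(** Conjugation is written without inverses, so u = 0 needs no separate case. *)
Definition acts_through A (p : 'AHom(C, A)) eta :=
  forall g u z, u \in hcomp A g -> u * p z = p (eta g z) * u.

Lemma associated_actionP A eta : graded_division A ->
  associated_action A eta <->
  exists2 p : 'AHom(C, A), base_embedding p & acts_through p eta.
Proof.
move=> gdA; split=> [[psi [psi_bij psiP]]|[p pA pP]].
  have [p pA pE] := base_embedding_subvs psi_bij; exists p => // g u z uA.
  have [->|u0] := eqVneq u 0; first by rewrite mulr0 mul0r.
  by rewrite !pE -(psiP g u) // divrK // (hcomp_unit gdA uA).
have [psi psi_bij psiE] := subvs_base_embedding pA; exists psi; split=> //.
move=> g u z uA u0; rewrite !psiE (pP g) // mulrK //.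
exact: hcomp_unit gdA _ _ uA u0.
Qed.

(** q sends i to some p w with w^2 = -1, hence w is i or its conjugate. *)
Lemma base_embedding_cases A (p q : 'AHom(C, A)) :
  base_embedding p -> base_embedding q ->
  q = p \/ q = (p \o conj_aend R)%AF.
Proof.
move=> [p_inj p_im] [q_inj q_im]; pose i := Rcomplex_i R.
have : q i \in limg p by rewrite p_im -q_im memv_img ?memvf.
case/memv_imgP => w _ qi; case: (@Rcomplex_sqrtN1 R w) => [|wE|wE].
- by apply: p_inj; rewrite rmorphM /= -qi -rmorphM Rcomplex_ii !rmorphN1.
- by left; apply/val_inj/lfunP/eq_on_i; rewrite qi wE.
- by right; apply/val_inj/lfunP/eq_on_i; rewrite comp_lfunE qi wE.
Qed.

Lemma acts_through_any A (p q : 'AHom(C, A)) eta : base_embedding p ->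
  base_embedding q -> acts_through p eta -> acts_through q eta.
Proof.
move=> pA qA pP g u z uA; have [->|->] := base_embedding_cases pA qA.
  exact: pP.
by rewrite !comp_lfunE (pP g) // aend_comm.
Qed.

Lemma acts_through_inj A (p : 'AHom(C, A)) eta eta' : graded_division A ->
  base_embedding p -> acts_through p eta -> acts_through p eta' -> eta' = eta.
Proof.
move=> gdA [p_inj _] pe pe'; apply: funext => g; apply: aend_ext => z.
have [u uA u0] := hcomp_neq0P gdA g; apply: p_inj.
by apply: (mulIr (hcomp_unit gdA uA u0)); rewrite -pe // -pe'.
Qed.

Lemma acts_through_aut A (p : 'AHom(C, A)) eta : graded_division A ->
  base_embedding p -> acts_through p eta -> is_aut_action eta.
Proof.
move=> gdA [p_inj _] pe; split=> [|g h].
  apply: aend_ext => z; apply: p_inj.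
  by have := pe 1%g 1 z (mem1_hcomp1 A); rewrite mul1r mulr1 id_lfunE.
apply: aend_ext => z; apply: p_inj; rewrite comp_lfunE.
have [u uA u0] := hcomp_neq0P gdA g; have [v vA v0] := hcomp_neq0P gdA h.
have Uu := hcomp_unit gdA uA u0; have Uv := hcomp_unit gdA vA v0.
have Uuv : u * v \is a GRing.unit by rewrite unitrMl.
apply: (mulIr Uuv); rewrite -pe ?mem_hcompM // -mulrA (pe h) //.
by rewrite mulrA (pe g) // mulrA.
Qed.

(** Conjugation by a nonzero u of degree g sends p i to p w with w^2 = -1, which fixes an
    automorphism. The rest of A_g is p(C) u, and commutativity of C gives it the same
    automorphism. *)
Lemma acts_through_exists A (p : 'AHom(C, A)) : graded_division A ->
  base_embedding p -> exists eta, acts_through p eta.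
Proof.
move=> gdA [p_inj p_im]; pose i := Rcomplex_i R.
suff /choice : forall g, exists f : 'AEnd(C), forall u z, u \in hcomp A g ->
  u * p z = p (f z) * u by case=> eta etaP; exists eta => g; apply: etaP.
move=> g; have [u uA u0] := hcomp_neq0P gdA g; have Uu := hcomp_unit gdA uA u0.
have pA z : p z \in hcomp A 1%g by rewrite -p_im memv_img ?memvf.
have upA : u * p i \in hcomp A g by rewrite -[g]mulg1 mem_hcompM.
have := mem_hcomp_div gdA u0 upA uA; rewrite -p_im => /memv_imgP[w _ wE].
have uw : u * p i = p w * u by rewrite -wE divrK.
have ww : w * w = -1.
  apply: p_inj; apply: (mulIr Uu); rewrite rmorphM /= -mulrA -uw mulrA -uw.
  by rewrite -mulrA -rmorphM Rcomplex_ii !rmorphN1 mulrN1 mulN1r.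
have [f fi] : exists f : 'AEnd(C), f i = w.
  have [->|->] := Rcomplex_sqrtN1 ww; last by exists (conj_aend R).
  by exists \1%AF; rewrite id_lfunE.
have uf z : u * p z = p (f z) * u.
  rewrite (RcomplexE z) !linearD !linearZ /= !rmorph1 mulrDr mulrDl fi.
  by rewrite -!scalerAr -!scalerAl mulr1 mul1r uw.
exists f => v z vA; have := mem_hcomp_div gdA u0 vA uA.
rewrite -p_im => /memv_imgP[t _ tE]; have -> : v = p t * u by rewrite -tE divrK.
by rewrite -mulrA uf !mulrA -!rmorphM [t * _]mulrC.
Qed.

Lemma complex_gda_action A : gda_over C A -> exists eta,
  [/\ is_aut_action eta, associated_action A eta &
      forall eta', associated_action A eta' -> eta' = eta].
Proof.
move=> [gdA /has_baseP[p pA]]; have [eta pe] := acts_through_exists gdA pA.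
exists eta; split; first exact: acts_through_aut pe.
  by apply/associated_actionP => //; exists p.
move=> eta' /(associated_actionP _ gdA)[q qA /(acts_through_any qA pA) pe'].
exact: acts_through_inj pe pe'.
Qed.

Section FixedAction.
Variable eta : gT -> 'AEnd(C).
Hypothesis etaA : is_aut_action eta.
Local Notation act := (fun g z => eta g z).
Local Notation cl := (cls (F := C) (fun g z => eta g z)).

Lemma complex_gb_acts A (p : 'AHom(C, A)) a u : graded_division A ->
  graded_basis p act a u -> acts_through p eta.
Proof.
move=> gdA pu g x z /(gb_hcompP gdA pu)[t ->].
by rewrite -mulrA (gb_comm pu) !mulrA -!rmorphM [t * _]mulrC.
Qed.

Lemma complex_gb_exists A (p : 'AHom(C, A)) : graded_division A ->
  base_embedding p -> acts_through p eta -> exists a u, graded_basis p act a u.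
Proof.
move=> gdA pA pe; have [p_inj p_im] := pA.
have /choice[u uP] g : exists u : A, u \in hcomp A g /\ u != 0.
  by have [u uA u0] := hcomp_neq0P gdA g; exists u.
have uA g : u g \in hcomp A g by case: (uP g).
have u0 g : u g != 0 by case: (uP g).
have /choice[a aE] (gh : gT * gT) :
    exists z, u gh.1 * u gh.2 = p z * u (gh.1 * gh.2)%g.
  case: gh => g h /=; have := mem_hcomp_div gdA (u0 (g * h)%g)
    (mem_hcompM (uA g) (uA h)) (uA (g * h)%g).
  rewrite -p_im => /memv_imgP[z _ zE]; exists z.
  by rewrite -zE divrK // (hcomp_unit gdA (uA _)).
exists (fun g h => a (g, h)), u; split=> // [g z|g h]; first exact: pe.
exact: (aE (g, h)).
Qed.

(** In u_g (u_h u_k), moving u_g past a(h,k) makes [eta] act; comparison with (u_g u_h) u_k gives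
    the identity. *)
Lemma complex_gb_cocycle A (p : 'AHom(C, A)) a u : graded_division A ->
  graded_basis p act a u -> cocycle2 act a.
Proof.
move=> gdA [[p_inj _] uA u0 up uM]; have Uu g := hcomp_unit gdA (uA g) (u0 g).
split=> [g h|g h k].
  apply/eqP => a0; have := unitrMl (u g) (Uu h).
  by rewrite uM a0 raddf0 mul0r unitr0 Uu.
apply: p_inj; apply: (mulIr (Uu (g * h * k)%g)).
rewrite !rmorphM /= -mulrA -uM mulrA -uM -mulrA uM mulrA up.
by rewrite -!mulrA uM mulgA.
Qed.

Lemma complex_gb_cohomologous A (p : 'AHom(C, A)) a b u v : graded_division A ->
  graded_basis p act a u -> graded_basis p act b v -> cohomologous act a b.
Proof.
move=> gdA pu pv; have [[p_inj _] uA u0 up uM] := pu.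
have [_ vA v0 _ vM] := pv; have Uu g := hcomp_unit gdA (uA g) (u0 g).
have /choice[l lE] g : exists z, v g = p z * u g.
  exact/(gb_hcompP gdA pu).
have l0 g : l g != 0.
  by apply: contraNneq (v0 g) => lg0; rewrite lE lg0 raddf0 mul0r.
exists l => // g h; have : b g h * l (g * h)%g = a g h * (l g * eta g (l h)).
  apply: p_inj; apply: (mulIr (Uu (g * h)%g)).
  rewrite rmorphM /= -mulrA -lE -vM !lE -mulrA [u g * _]mulrA up.
  by rewrite -!mulrA uM !mulrA -!rmorphM; congr (p _ * _);
    rewrite [LHS]mulrC mulrA.
by move=> e; rewrite mulrA -e mulfK.
Qed.

Lemma complex_gb_change A (p : 'AHom(C, A)) a b u : graded_division A ->
  graded_basis p act a u -> cohomologous act a b ->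
  exists v, graded_basis p act b v.
Proof.
move=> gdA pu [l l0 bE]; have [[p_inj p_im] uA u0 up uM] := pu.
exists (fun g => p (l g) * u g); split=> [||g|g z|g h] //.
- by move=> g; apply/(gb_hcompP gdA pu); exists (l g).
- apply/eqP => e; have := l0 g; apply/negP; rewrite negbK; apply/eqP/p_inj.
  by apply: (mulIr (hcomp_unit gdA (uA g) (u0 g))); rewrite raddf0 mul0r.
- by rewrite -mulrA up !mulrA -!rmorphM mulrC.
- rewrite -mulrA [u g * _]mulrA up -!mulrA uM !mulrA -!rmorphM; congr (p _ * _).
  by rewrite bE !mulrA divfK // [LHS]mulrC mulrA.
Qed.

Lemma complex_gb_cls A (p : 'AHom(C, A)) a u : graded_division A ->
  graded_basis p act a u ->
  cl a = [set b | exists v : gT -> A, graded_basis p act b v].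
Proof.
move=> gdA pu; apply/seteqP; split=> b /= => [|[v]].
  exact: complex_gb_change pu.
exact: complex_gb_cohomologous pu.
Qed.

(** The same u_g serve for the conjugate identification. Their products are unchanged, so their
    coefficients in C are conjugated. *)
Lemma complex_gb_conj A (p : 'AHom(C, A)) a u : graded_basis p act a u ->
  graded_basis (p \o conj_aend R)%AF act (conj_cochain a) u.
Proof.
case=> [[p_inj p_im] uA u0 up uM]; split=> // [|g z|g h].
- split=> [x y|]; first rewrite !comp_lfunE => /p_inj.
    by rewrite -{2}[x]conj_aendK => ->; rewrite conj_aendK.
  rewrite limg_comp -p_im; congr (p @: _)%VS; apply/vspaceP => z.
  rewrite memvf; apply/memv_imgP; exists (conj_aend R z); rewrite ?memvf //.
  by rewrite conj_aendK.
- by rewrite !comp_lfunE up aend_comm.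
- by rewrite comp_lfunE uM /conj_cochain -conj_aendE conj_aendK.
Qed.

(** No identification of A_e with C is singled out: each of the two contributes its class, whence a
    pair. *)
Definition complex_class A : set (set (gT -> gT -> C)) :=
  [set X | exists (p : 'AHom(C, A)) a u,
     graded_basis p (fun g z => eta g z) a u /\ X = cl a].

Lemma complex_class_pair A (p : 'AHom(C, A)) a u : graded_division A ->
  graded_basis p act a u -> complex_class A = conj_pair eta a.
Proof.
move=> gdA pu; have pcu := complex_gb_conj pu.
apply/seteqP; split=> X /=.
  move=> [q [b [v [qv ->]]]].
  have [qp|qp] := base_embedding_cases (gb_base pu) (gb_base qv);
    rewrite qp in qv; [left|right].
    by rewrite (complex_gb_cls gdA qv) (complex_gb_cls gdA pu).
  by rewrite (complex_gb_cls gdA qv) (complex_gb_cls gdA pcu).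
by case=> ->; [exists p, a, u|exists (p \o conj_aend R)%AF, (conj_cochain a), u].
Qed.

Theorem complex_iso_classes :
  iso_classes_bijection
    (fun A => gda_over C A /\ associated_action A eta) (conj_pairs eta).
Proof.
have basis A : gda_over C A /\ associated_action A eta ->
    graded_division A /\
    exists (p : 'AHom(C, A)) a u, graded_basis p act a u.
  case=> -[gdA _] /(associated_actionP _ gdA)[p pA pe]; split=> //.
  by exists p; apply: complex_gb_exists.
exists complex_class; split.
- move=> A /basis[gdA [p [a [u pu]]]]; exists a; last first.
    by rewrite (complex_class_pair gdA pu).
  exact: complex_gb_cocycle gdA pu.
- move=> A B /basis[gdA [p [a [u pu]]]] /basis[gdB _]; split=> [AB|].
    have : complex_class B (cl a) by rewrite -AB; exists p, a, u.
    move=> [q [b [v [qv ab]]]].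
    (* As [a] lies in its own class, [B] has a graded basis along q with cocycle [a] itself. *)
    have : cl a a by rewrite (complex_gb_cls gdA pu) /=; exists u.
    rewrite ab (complex_gb_cls gdB qv) /= => -[w qw].
    exact: graded_basis_iso pu qw.
  move=> [f [f_bij f_im]]; have fpu := graded_basis_transport f_bij f_im pu.
  by rewrite (complex_class_pair gdA pu) (complex_class_pair gdB fpu).
- move=> _ [a [a0 aM] <-].
  (* The pair of [a] is realised by the crossed product of C by [eta] and [a]. *)
  have sa : crossed_system eta a.
    split=> [z|g h z|g h|g h z|g h k].
    - by case: etaA => -> _; rewrite id_lfunE.
    - exact: aut_actionM.
    - by rewrite unitfE.
    - by rewrite mulrC.
    - exact: aM.
  have gb := cp_graded_basis sa.
  have gd : graded_division (crossed_product sa).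
    by apply: crossed_product_division => z; rewrite unitfE.
  exists (crossed_product sa); last exact: complex_class_pair gd gb.
  split; first by split=> //; apply/has_baseP; eexists; exact: gb_base gb.
  apply/associated_actionP => //; eexists; first exact: gb_base gb.
  exact: complex_gb_acts gd gb.
Qed.

End FixedAction.
End ComplexBase.

Theorem corollaryB (R : realType) (gT : finGroupType) :
  [/\ forall A : gradedAlg R gT, graded_division A ->
        [\/ has_base R^o A, has_base (quat R) A | has_base (Rcomplex R) A],
      [/\ forall a (ha : cocycle2 (@trivial_act R gT) a),
            gda_over R^o (twisted_group_alg ha),
          forall A : gradedAlg R gT, gda_over R^o A ->
            exists a (ha : cocycle2 (@trivial_act R gT) a),
              graded_iso A (twisted_group_alg ha) &
          forall a b (ha : cocycle2 (@trivial_act R gT) a)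
              (hb : cocycle2 (@trivial_act R gT) b),
            graded_iso (twisted_group_alg ha) (twisted_group_alg hb) <->
            cls (@trivial_act R gT) a = cls (@trivial_act R gT) b],
      iso_classes_bijection (@gda_over R gT (quat R)) (H2 (@trivial_act R gT)) &
      [/\ forall A : gradedAlg R gT, gda_over (Rcomplex R) A ->
            exists eta : gT -> 'AEnd(Rcomplex R),
              [/\ is_aut_action eta, associated_action A eta,
                  forall eta', associated_action A eta' -> eta' = eta &
                  exists N : {group gT}, aut_action_ker eta = N /\
                    (N = [set: gT]%G \/ #|[set: gT]%SET : N|%g = 2%N)],
          set_bij
            [set eta : gT -> 'AEnd(Rcomplex R) |
              is_aut_action eta /\ ~ trivial_aut_action eta]
            (@index2_subgroups gT) (@aut_action_ker R gT) &
          forall (N : {group gT}) (eta : gT -> 'AEnd(Rcomplex R)),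
            N = [set: gT]%G \/ #|[set: gT]%SET : N|%g = 2%N ->
            is_aut_action eta -> aut_action_ker eta = N ->
            iso_classes_bijection
              (fun A => gda_over (Rcomplex R) A /\ associated_action A eta)
              (conj_pairs eta)]].
Proof.
have central_reg (z : R^o) : (forall y, z * y = y * z) -> exists k : R, z = k%:A.
  by move=> _; apply: regular_central.
(* The u_g of the twisted group algebra form a central basis with cocycle [a]; isomorphisms can thus
   be decided on classes. *)
have reg_cls a (ha : cocycle2 (@trivial_act R gT) a) :
    central_class (twisted_group_alg ha) = cls (@trivial_act R gT) a.
  by apply: (central_class_cls central_reg);
    [apply: twisted_gda|apply: twisted_central_basis].
have iso_regP := central_class_isoP central_reg (@regular_centralizing R gT).
split.
- by move=> A; apply: graded_division_base.
- split=> [a ha|A PA|a b ha hb]; first exact: twisted_gda.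
    have [u [a ua]] :=
      central_basis_exists central_reg (@regular_centralizing R gT) PA.
    have ha : cocycle2 (@trivial_act R gT) a.
      by apply: central_basis_cocycle ua; case: PA.
    exists a, ha; apply/(iso_regP _ _ PA (twisted_gda ha)).
    by rewrite reg_cls (central_class_cls central_reg PA ua).
  by rewrite -!reg_cls; split=> /(iso_regP _ _ (twisted_gda ha) (twisted_gda hb)).
- apply: (central_iso_classes _ (@quat_centralizing R gT)).
    exact: quat_central.
  exact: quat_neq0_unit.
- split; last 1 first.
  + by move=> _ eta _ etaA _; apply: complex_iso_classes.
  + move=> A /complex_gda_action[eta [etaA assoc uniq]]; exists eta; split=> //.
    exists (Group (aut_action_ker_group etaA)); split=> //.
    have [eta1|] := pselect (trivial_aut_action eta).
      by left; apply/val_inj/setP => g; rewrite !inE eta1 eqxx.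
    by right; apply: aut_action_ker_index.
  + exact: aut_action_bij.
Qed.
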